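(* Let $k\ge 1$ be an integer, let $(X,\|\cdot\|_X)$ be a reflexive and separable Banach space with Borel $\sigma$-algebra $\mathcal{X}$, let $P$ be a probability measure on $(X,\mathcal{X})$, and let $\{\xi_i\}_{i\in\mathbb{N}}$ be a sequence of independent $X$-valued random elements with common law $P$ defined on a probability space $(\Omega,\mathcal{F},\mathbb{P})$. Let $d:X\times X\to[0,\infty)$ and assume that: (1) there exist continuous, strictly increasing functions $m,M:[0,\infty)\to[0,\infty)$ such that $m(\|x-y\|_X)\le d(x,y)\le M(\|x-y\|_X)$ for all $x,y\in X$, with $\lim_{r\to\infty}m(r)=\infty$, $M(0)=0$, there exists $\gamma<\infty$ such that $M(\|x+y\|_X)\le\gamma M(\|x\|_X)+\gamma M(\|y\|_X)$ for all $x,y\in X$, and $\int_X M(\|x\|_X)\,P(\mathrm{d}x)<\infty$; (2) for each $x,y\in X$, if $x_m\to x$ (in norm) and $y_n\rightharpoonup y$ (weakly) as $n,m\to\infty$, then $\liminf_{n,m\to\infty}d(x_m,y_n)\ge d(x,y)$ and $\lim_{m\to\infty}d(x_m,y)=d(x,y)$; (3) for each $y\in X$ the function $d(\cdot,y)$ is $\mathcal{X}$-measurable; (4) there exist $k$ different points $\mu_1^\dagger,\dots,\mu_k^\dagger\in X$ such that for all $\delta>0$ and all $j=1,\dots,k$, $P(B(\mu_j^\dagger,\delta))>0$, where $B(\mu,\delta)=\{x\in X:\|\mu-x\|_X<\delta\}$. For $\mu=(\mu_1,\dots,\mu_k)\in X^k$ define $$f_n^{(\omega)}(\mu)=\frac1n\sum_{i=1}^n\min_{1\le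 j\le k}d(\xi_i^{(\omega)},\mu_j),\qquad f_\infty(\mu)=\int_X\min_{1\le j\le k}d(x,\mu_j)\,P(\mathrm{d}x).$$ Then for $\mathbb{P}$-almost every $\omega$, $$\min_{\mu\in X^k}f_\infty(\mu)=\lim_{n\to\infty}\min_{\mu\in X^k}f_n^{(\omega)}(\mu).$$ Furthermore, any sequence of minimizers $\mu^n$ of $f_n^{(\omega)}$ is almost surely weakly precompact and any weak limit point minimizes $f_\infty$.
   Context: $\xi_i^{(\omega)}$ denotes the value of $\xi_i$ at $\omega\in\Omega$. The product $X^k$ carries the norm $\|\mu\|_k=\max_j\|\mu_j\|_X$, and weak convergence in $X^k$ is weak convergence with respect to this Banach space structure (equivalently, componentwise weak convergence). A sequence is weakly precompact if every subsequence has a weakly convergent further subsequence; a weak limit point of a sequence is the weak limit of some subsequence. *)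

(* Defs.v *)
From HB Require Import structures.
From mathcomp Require Import all_boot all_order all_algebra finmap.
From mathcomp Require Import all_classical all_reals all_analysis.

Set Implicit Arguments.
Unset Strict Implicit.
Unset Printing Implicit Defensive.

Import Order.TTheory GRing.Theory Num.Theory.
Import numFieldNormedType.Exports.

Local Open Scope classical_set_scope.
Local Open Scope ring_scope.

Section Dual.
Context {R : realType} (V : normedModType R).

Definition cont_linear : {pred V -> R^o} :=
  [pred f : V -> R^o | `[< linear f /\ continuous f >]].

Fact cont_linear_submod_closed : submod_closed cont_linear.
Proof.
split=> [|a f g].
  rewrite inE; split; last exact: cst_continuous.
  by move=> b x y /=; rewrite scaler0 addr0.
rewrite !inE => -[fl fc] [gl gc]; split=> [b x y|x].
  rewrite !fctE fl gl !scalerDr !scalerA [b * a]mulrC -!addrA; congr (_ + _).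
  by rewrite addrCA.
by apply: cvgD; [apply: cvgZl_tmp; exact: fc | exact: gc].
Qed.

HB.instance Definition _ :=
  GRing.isSubmodClosed.Build R (V -> R^o) cont_linear cont_linear_submod_closed.

Record dual := Dual { dual_fun :> V -> R^o ; _ : dual_fun \in cont_linear }.

HB.instance Definition _ := [isSub for dual_fun].
HB.instance Definition _ := [Choice of dual by <:].
HB.instance Definition _ := [SubChoice_isSubLmodule of dual by <:].

Implicit Types f g : dual.

Lemma dual_linear f : linear f.
Proof. by have /asboolP[] : dual_fun f \in cont_linear := valP f. Qed.

Lemma dual_continuous f : continuous f.
Proof. by have /asboolP[] : dual_fun f \in cont_linear := valP f. Qed.

Definition dual_norm f : R := sup [set `|f x| | x in [set x : V | `|x| <= 1]].

Lemma dualZ f a x : f (a *: x) = a * f x.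
Proof.
pose L : {linear V -> R^o} :=
  HB.pack (dual_fun f) (GRing.isLinear.Build _ _ _ _ _ (dual_linear f)).
exact: (linearZ_LR L).
Qed.

Lemma dual0 f : f 0 = 0.
Proof. by rewrite -(scale0r (0 : V)) dualZ mul0r. Qed.

Lemma dual_norm_has_sup f : has_sup [set `|f x| | x in [set x : V | `|x| <= 1]].
Proof.
split; first by exists `|f 0|, 0 => //=; rewrite normr0 ler01.
pose L : {linear V -> R^o} :=
  HB.pack (dual_fun f) (GRing.isLinear.Build _ _ _ _ _ (dual_linear f)).
have /bounded_funP /(_ 1)[M LM] : bounded_near L (nbhs (0 : V)).
  by apply/linear_bounded_continuous; exact: dual_continuous.
by exists M => _ [x /= x1 <-]; exact: LM.
Qed.

Lemma dual_norm_ub f x : `|x| <= 1 -> `|f x| <= dual_norm f.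
Proof.
move=> x1; apply: sup_upper_bound; last by exists x.
exact: dual_norm_has_sup.
Qed.

Lemma dual_norm_le f c :
  (forall x, `|x| <= 1 -> `|f x| <= c) -> dual_norm f <= c.
Proof.
move=> fc; apply: ge_sup; first by case: (dual_norm_has_sup f).
by move=> _ [x x1 <-]; exact: fc.
Qed.

Lemma dual_normD f g : dual_norm (f + g) <= dual_norm f + dual_norm g.
Proof.
apply: dual_norm_le => x x1.
by rewrite (le_trans (ler_normD _ _))// lerD// dual_norm_ub.
Qed.

Lemma dual_normZ_le a f : dual_norm (a *: f) <= `|a| * dual_norm f.
Proof.
apply: dual_norm_le => x x1.
by rewrite normrM ler_wpM2l// dual_norm_ub.
Qed.

Lemma dual_normZ a f : dual_norm (a *: f) = `|a| * dual_norm f.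
Proof.
have [->|a0] := eqVneq a 0.
  rewrite scale0r normr0 mul0r; apply/eqP; rewrite eq_le.
  rewrite dual_norm_le ?(le_trans _ (@dual_norm_ub 0 0 _)) ?normr0//.
  by move=> x _; rewrite normr0.
apply/eqP; rewrite eq_le dual_normZ_le /=.
rewrite -ler_pdivlMl ?normr_gt0// -normfV.
by rewrite -[in leLHS](scalerK a0 f) dual_normZ_le.
Qed.

Lemma dual_norm_eq0 f : dual_norm f = 0 -> f = 0.
Proof.
move=> f0; apply/val_inj/funext => x /=.
have [->|x0] := eqVneq x 0; first by rewrite dual0.
have nx0 : `|x| != 0 by rewrite normr_eq0.
have := @dual_norm_ub f (`|x|^-1 *: x).
rewrite f0 normrZ normfV normr_id mulVf// => /(_ (lexx _)).
by rewrite normr_le0 dualZ mulf_eq0 invr_eq0 (negPf nx0) => /eqP.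
Qed.

HB.instance Definition _ :=
  Lmodule_isNormed.Build R dual dual_normD dual_normZ dual_norm_eq0.

End Dual.

(* The canonical embedding of V into its bidual is onto. *)
Definition reflexive_space (R : realType) (V : normedModType R) : Prop :=
  forall Phi : dual (dual V), exists x : V, forall f : dual V, Phi f = f x.

Definition separable (T : topologicalType) : Prop :=
  exists2 D : set T, countable D & dense D.

Section WeakConvergence.
Context {R : realType} {V : normedModType R}.
Implicit Types (u : nat -> V) (l : V).

Definition weak_cvg u l : Prop :=
  forall f : dual V, f (u n) @[n --> \oo] --> f l.

Definition weak_limit_point u l : Prop :=
  exists h : nat -> nat, increasing_seq h /\ weak_cvg (u \o h) l.

Definition weakly_precompact u : Prop :=
  forall h : nat -> nat, increasing_seq h -> exists l, weak_limit_point (u \o h) l.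

End WeakConvergence.

(* V^k, as an alias of {ffun 'I_k -> V} that receives the max norm. *)
Definition kprod (V : Type) (k : nat) : Type := {ffun 'I_k -> V}.

Section KProd.
Context {R : realType} (V : normedModType R) (k : nat).

HB.instance Definition _ := GRing.Lmodule.copy (kprod V k) {ffun 'I_k -> V}.

Definition kprod_norm (mu : kprod V k) : R := \big[Num.max/0]_(j < k) `|mu j|.

Lemma kprod_normD (mu nu : kprod V k) :
  kprod_norm (mu + nu) <= kprod_norm mu + kprod_norm nu.
Proof.
have ge0 (w : kprod V k) : 0 <= kprod_norm w by exact: bigmax_ge_id.
apply/bigmax_leP; split=> [|j _]; first exact: addr_ge0.
rewrite ffunE (le_trans (ler_normD _ _))// lerD//;
  exact: (le_bigmax _ (fun j => `|_ j|)).
Qed.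

Lemma kprod_normZ (a : R) (mu : kprod V k) :
  kprod_norm (a *: mu) = `|a| * kprod_norm mu.
Proof.
rewrite /kprod_norm; under eq_bigr do rewrite ffunE normrZ.
elim/big_ind2 : _ => // [|x x' y y' -> ->]; first by rewrite mulr0.
by rewrite maxr_pMr.
Qed.

Lemma kprod_norm_eq0 (mu : kprod V k) : kprod_norm mu = 0 -> mu = 0.
Proof.
move=> mu0; apply/ffunP => j; rewrite ffunE; apply/eqP.
by rewrite -normr_le0 -mu0; exact: (le_bigmax _ (fun j => `|mu j|)).
Qed.

HB.instance Definition _ :=
  Lmodule_isNormed.Build R (kprod V k) kprod_normD kprod_normZ kprod_norm_eq0.

End KProd.

Definition borel (T : ptopologicalType) : Type := g_sigma_algebraType (@open T).

HB.instance Definition _ (T : ptopologicalType) :=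
  Measurable.copy (borel T) (g_sigma_algebraType (@open T)).

Definition mutually_independent (R : realType) (d d' : measure_display)
    (Omega : measurableType d) (T : measurableType d') (Pr : probability Omega R)
    (I : choiceType) (X : I -> {RV Pr >-> T}) : Prop :=
  forall (J : {fset I}) (A : I -> set T), (forall i, measurable (A i)) ->
  (Pr (\bigcap_(i in [set` J]) X i @^-1` A i) =
   \prod_(i <- J) Pr (X i @^-1` A i))%E.

Section Minimisation.
Context {R : realType} {T : Type}.
Implicit Types (f : T -> \bar R).
Local Open Scope ereal_scope.

Definition is_minimizer f (t : T) : Prop := forall s : T, f t <= f s.

Definition is_min f (v : \bar R) : Prop := exists2 t, is_minimizer f t & f t = v.

End Minimisation.

Section KMeans.
Context {R : realType} {X : normedModType R}.
Variables (d : X -> X -> R) (k : nat).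
Local Open Scope ereal_scope.

(* The default value +oo is only reached when k = 0. *)
Definition min_dist (x : X) (mu : kprod X k) : \bar R :=
  \big[mine/+oo]_(j < k) (d x (mu j))%:E.

(* For n = 0 this is the constant 0; only n >= 1 is meaningful. *)
Definition kmeans_emp (n : nat) (xi : nat -> X) (mu : kprod X k) : \bar R :=
  (n%:R^-1)%:E * \sum_(0 <= i < n) min_dist (xi i) mu.

Definition kmeans_lim (P : probability (borel X) R) (mu : kprod X k) : \bar R :=
  \int[P]_x min_dist x mu.

End KMeans.

(* Main.v *)
Require Import Defs.
From HB Require Import structures.
From mathcomp Require Import all_boot all_order all_algebra finmap.
From mathcomp Require Import all_classical all_reals all_analysis.
From mathcomp Require Import measurable_realfun ring lra.

(** The proof is the direct method of the calculus of variations, run almost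
    surely along the empirical measures.

    Write [f_n] and [f_infty] as integrals of the same integrand [min_dist d _ mu]
    against the empirical measure and against [P]. Three facts are needed.

    Compactness. A bounded sequence of a separable reflexive space has a weakly
    convergent subsequence ([bounded_weak_limit_point]); the Hahn-Banach theorem
    ([norming_functional]) provides enough functionals to identify limits. So
    any sequence of k-tuples has a subsequence along which, for some set [J] of
    indices, the components in [J] converge weakly and the other ones tend to
    infinity in norm ([partial_weak_cvg_extraction]). Since [m] is unbounded,
    the latter components do not contribute in the limit, and the limit
    integrand is [min_dist_on d J _ l], a minimum over [J] only. Together with
    Fatou's lemma this gives minimizers for all the energies
    ([kmeans_minimizer]).

    Lower bound ([kmeans_gamma_liminf]). By the joint lower semicontinuity of
    [d], if [c < min_dist_on d J x l], then [c <= min_dist d z (u n)] for [z]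
    near [x] and [n] large. Hence a countable family of bounded functions
    has a member [step_max a s] which is below [min_dist d _ (u n)] for all
    large [n] and whose integral exceeds any given number less than the integral
    of the limit integrand. The strong law of large numbers for the members of
    the family holds almost surely for all of them at once
    ([empirical_steps_ae]), so the null set does not depend on the sequence [u].

    Upper bound. The strong law at one fixed minimizer [mu0] of [f_infty] bounds
    [f_n mu0], hence the minimum of [f_n], by [f_infty mu0] asymptotically. The
    law is proved for nonnegative variables and from above ([slln_upper]), by
    Etemadi's truncation method along geometric times; applied to [C - phi],
    it gives the bound from below for functions bounded by [C].

    Combining the two bounds, any limit [(J, l)] of minimizers satisfies
    [\int[P]_x min_dist_on d J x l <= f_infty mu0]. If [J] were not the full set,
    one of the [k] points of the support of [P] would be away from all the
    centres in use, and adding it as a centre would strictly lower the energy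
    below its minimum ([min_dist_on_improvable]). So no component escapes, the
    minimizers are weakly precompact, and their limits are minimizers. *)

Import Order.TTheory GRing.Theory Num.Theory.
Import numFieldNormedType.Exports.

Local Open Scope classical_set_scope.
Local Open Scope ring_scope.

(** * The Hahn-Banach theorem *)

Definition sublinear {R : realType} {V : lmodType R} (p : V -> R) : Prop :=
  (forall x y, p (x + y) <= p x + p y) /\
  (forall t x, 0 < t -> p (t *: x) <= t * p x).

Lemma sublinear0 {R : realType} {V : lmodType R} {p : V -> R} :
  sublinear p -> p 0 = 0.
Proof.
move=> [pD pZ]; have := pD 0 0; rewrite addr0.
by have := pZ 2^-1 0 ltac:(lra); rewrite scaler0; lra.
Qed.

Lemma sublinearZ {R : realType} {V : lmodType R} {p : V -> R} (t : R) x :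
  sublinear p -> 0 <= t -> p (t *: x) = t * p x.
Proof.
move=> sp; rewrite le_eqVlt => /orP[/eqP <-|t0].
  by rewrite scale0r mul0r sublinear0.
apply/eqP; rewrite eq_le (sp.2 _ _ t0) /= -ler_pdivlMl//.
by rewrite -[in leLHS](scalerK (lt0r_neq0 t0) x) (sp.2 t^-1)// invr_gt0.
Qed.

Lemma sublinear_opp_ge {R : realType} {V : lmodType R} {p : V -> R} x :
  sublinear p -> - p (- x) <= p x.
Proof.
by move=> sp; have := sp.1 x (- x); rewrite subrr sublinear0//; lra.
Qed.

(** The largest sublinear functional below [p] whose value at [- y] is at most
    [- p y], that is, which is linear on the line spanned by [y]. *)
Definition linearize_along {R : realType} {V : lmodType R} (p : V -> R) (y x : V) :=
  inf [set p (x + t *: y) - t * p y | t in [set t : R | 0 <= t]].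

Lemma linearize_along_le {R : realType} {V : lmodType R} (p : V -> R) y x t :
  sublinear p -> 0 <= t -> linearize_along p y x <= p (x + t *: y) - t * p y.
Proof.
move=> sp t0; apply: ge_inf; last by exists t.
exists (- p (- x)) => _ [s /= s0 <-].
have := sp.1 (x + s *: y) (- x).
by rewrite addrC addKr sublinearZ//; lra.
Qed.

Lemma sublinear_linearize_along {R : realType} {V : lmodType R} (p : V -> R) y :
  sublinear p -> sublinear (linearize_along p y).
Proof.
move=> sp.
have ne x : [set p (x + t *: y) - t * p y | t in [set t : R | 0 <= t]] !=set0.
  by exists (p (x + 0 *: y) - 0 * p y), 0 => /=.
split=> [a b|t x t0].
  rewrite -lerBlDr; apply: (lb_le_inf (ne _)) => _ [s /= s0 <-].
  rewrite lerBlDr -lerBlDl; apply: (lb_le_inf (ne _)) => _ [t /= t0 <-].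
  rewrite lerBlDr (le_trans (linearize_along_le _ _ _ _ sp (addr_ge0 s0 t0)))//.
  have := sp.1 (a + s *: y) (b + t *: y).
  by rewrite addrACA -scalerDl; lra.
rewrite -ler_pdivrMl//; apply: (lb_le_inf (ne _)) => _ [s /= s0 <-].
rewrite ler_pdivrMl//.
rewrite (le_trans (linearize_along_le _ _ _ _ sp (mulr_ge0 (ltW t0) s0)))//.
rewrite -scalerA -scalerDr (sublinearZ _ _ sp)//; last exact: ltW.
by lra.
Qed.

Lemma linearize_along_opp {R : realType} {V : lmodType R} (p : V -> R) y :
  sublinear p -> linearize_along p y (- y) <= - p y.
Proof.
move=> sp; apply: (le_trans (linearize_along_le _ _ _ _ sp ler01)).
by rewrite scale1r addNr sublinear0// mul1r sub0r.
Qed.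

Lemma linearize_along_id {R : realType} {V : lmodType R} (p : V -> R) y x :
  sublinear p -> linearize_along p y x <= p x.
Proof.
move=> sp; apply: (le_trans (linearize_along_le _ y x _ sp (lexx 0))).
by rewrite scale0r addr0 mul0r subr0.
Qed.

(** A minimal sublinear functional coincides with all its linearizations, so
    it is linear; Zorn's lemma provides a minimal one below [p]. *)
Lemma sublinear_linear_minorant {R : realType} {V : lmodType R} (p : V -> R) :
  sublinear p -> exists2 f : V -> R^o, linear f & forall x, f x <= p x.
Proof.
move=> sp.
pose Q (q : V -> R) := sublinear q /\ forall x, q x <= p x.
pose T := {q : V -> R | Q q}.
pose ord (q r : T) := `[< forall x, sval r x <= sval q x >].
have [||||[f [sf fp]] fmin] := @Zorn T ord.
- by move=> q; apply/asboolP.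
- move=> q r s /asboolP qr /asboolP rs; apply/asboolP => x.
  exact: le_trans (rs x) (qr x).
- move=> [q hq] [r hr] /asboolP/= qr /asboolP/= rq; apply: eq_exist => /=.
  by apply/funext => x; apply/eqP; rewrite eq_le qr rq.
- move=> A totA; have [A0|/set0P[a0 Aa0]] := eqVneq A set0.
    have pp : Q p by [].
    by exists (exist Q p pp) => s; rewrite A0.
  pose E x := [set sval a x | a in A].
  have Ene x : E x !=set0 by exists (sval a0 x), a0.
  have Elb x a : A a -> inf (E x) <= sval a x.
    move=> Aa; apply: ge_inf; last by exists a.
    exists (- p (- x)) => _ [[b [sb bp]] Ab <-] /=.
    by rewrite (le_trans _ (sublinear_opp_ge x sb))// lerN2.
  have qP : Q (fun x => inf (E x)).
    split; last first.
      by move=> x; apply: (le_trans (Elb x a0 Aa0)); exact: (proj2 (svalP a0)).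
    split=> [x y|t x t0].
      rewrite -lerBlDr; apply: (lb_le_inf (Ene _)) => _ [a Aa <-].
      rewrite lerBlDr -lerBlDl; apply: (lb_le_inf (Ene _)) => _ [b Ab <-].
      rewrite lerBlDl.
      have [/asboolP ab|/asboolP ba] := totA a b Aa Ab.
        rewrite (le_trans (Elb _ b Ab))// (le_trans ((svalP b).1.1 x y))//.
        by rewrite lerD2r.
      rewrite (le_trans (Elb _ a Aa))// (le_trans ((svalP a).1.1 x y))//.
      by rewrite lerD2l.
    rewrite -ler_pdivrMl//; apply: (lb_le_inf (Ene _)) => _ [a Aa <-].
    by rewrite ler_pdivrMl// (le_trans (Elb _ a Aa))// (svalP a).1.2.
  exists (exist Q _ qP) => a Aa; apply/asboolP => x /=; exact: Elb.
have fN y : f (- y) = - f y.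
  have hq : Q (linearize_along f y).
    split; first exact: sublinear_linearize_along.
    by move=> x; exact: le_trans (linearize_along_id _ _ _ sf) (fp x).
  have /(congr1 sval)/= fE : exist Q _ hq = exist Q f (conj sf fp) :> T.
    by apply: fmin; apply/asboolP => x /=; exact: linearize_along_id.
  apply/eqP; rewrite eq_le; apply/andP; split.
    by rewrite -[in leLHS]fE linearize_along_opp.
  by rewrite lerNl; have := sublinear_opp_ge (- y) sf; rewrite opprK; lra.
exists f => // a x y.
have fD u v : f (u + v) = f u + f v.
  apply/eqP; rewrite eq_le sf.1 /=.
  by have := sf.1 (u + v) (- v); rewrite addrK fN; lra.
rewrite fD; congr (_ + _).
have [a0|a0] := leP 0 a; first by rewrite (sublinearZ _ _ sf a0).
apply: oppr_inj; rewrite -fN -scaleNr (sublinearZ _ _ sf); last by lra.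
by rewrite mulNr.
Qed.

Lemma norm_sublinear {R : realType} (V : normedModType R) :
  sublinear (fun x : V => `|x|).
Proof.
split=> [x y|t x t0]; first exact: ler_normD.
by rewrite normrZ gtr0_norm.
Qed.

Lemma dual_of_bounded {R : realType} {V : normedModType R} (f : V -> R^o) (c : R) :
  linear f -> (forall x, `|f x| <= c * `|x|) -> exists g : dual V, g = f :> (V -> R^o).
Proof.
move=> lf fc.
pose L : {linear V -> R^o} :=
  HB.pack f (GRing.isLinear.Build _ _ _ _ _ lf).
have cf : continuous L.
  apply: bounded_linear_continuous; apply/linear_boundedP.
  exists c; split; first exact: num_real.
  by move=> r cr x; apply: (le_trans (fc x)); rewrite ler_wpM2r// ltW.
have inD : f \in @cont_linear R V by rewrite inE; split.
by exists (@Dual R V f inD).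
Qed.

(** Linearizing the norm along [x] before taking a linear minorant forces the
    value [`|x|] at [x]. *)
Theorem norming_functional {R : realType} {V : normedModType R} (x : V) :
  exists2 f : dual V, f x = `|x| & forall y, `|f y| <= `|y|.
Proof.
have sn := norm_sublinear V.
have [f lf fp] := sublinear_linear_minorant _ (sublinear_linearize_along _ x sn).
have fle y : f y <= `|y| by exact: le_trans (fp y) (linearize_along_id _ _ _ sn).
pose L : {linear V -> R^o} := HB.pack f (GRing.isLinear.Build _ _ _ _ _ lf).
have fN y : f (- y) = - f y by exact: (linearN L).
have fb y : `|f y| <= `|y|.
  by rewrite ler_norml fle andbT lerNl -fN (le_trans (fle _))// normrN.
have [|g gE] := dual_of_bounded f 1 lf; first by move=> y; rewrite mul1r.
exists g; rewrite gE//; apply/eqP; rewrite eq_le fle /=.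
by rewrite -lerN2 -fN (le_trans (fp _))// linearize_along_opp.
Qed.

(** * Subsequences *)

Lemma subseq_of_frequently (Q : nat -> nat -> Prop) :
  (forall i N, exists2 n, (N <= n)%N & Q i n) ->
  exists2 h : nat -> nat, increasing_seq h & forall n, Q n (h n).
Proof.
move=> freq.
have [|c cP] := @choice (nat * nat) nat
    (fun iN n => (iN.2 <= n)%N /\ Q iN.1 n).
  by move=> [i N]; have [n] := freq i N; exists n.
pose h := fix h n := if n is n'.+1 then c (n, (h n').+1) else c (0%N, 0%N).
exists h; last by case=> [|n]; [exact: (cP (_, _)).2 | exact: (cP (_, _)).2].
by apply/increasing_seqP => n; exact: (cP (n.+1, (h n).+1)).1.
Qed.

Lemma increasing_seq_comp (g h : nat -> nat) :
  increasing_seq g -> increasing_seq h -> increasing_seq (g \o h).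
Proof. by move=> gi hi m n; rewrite [LHS]gi; exact: hi. Qed.

Lemma increasing_seq_ge (h : nat -> nat) n : increasing_seq h -> (n <= h n)%N.
Proof.
move=> /increasing_seqP hi; elim: n => // n IH.
by apply: leq_ltn_trans IH _; exact: hi.
Qed.

Lemma increasing_seq_cvg (h : nat -> nat) :
  increasing_seq h -> h n @[n --> \oo] --> \oo.
Proof.
move=> hi A [N _ NA]; exists N => // n /= Nn; apply: NA => /=.
exact: leq_trans Nn (increasing_seq_ge h n hi).
Qed.

Lemma cvg_subseq {T : topologicalType} (u : nat -> T) (h : nat -> nat) (l : T) :
  increasing_seq h -> u n @[n --> \oo] --> l -> u (h n) @[n --> \oo] --> l.
Proof. by move=> /increasing_seq_cvg hi; exact: cvg_comp. Qed.

Lemma weak_cvg_subseq {R : realType} {V : normedModType R} (u : nat -> V) h l :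
  increasing_seq h -> weak_cvg u l -> weak_cvg (u \o h) l.
Proof. by move=> hi ul f; exact: (cvg_subseq (f \o u) h _ hi (ul f)). Qed.

(** * Weak sequential compactness in separable reflexive spaces *)

Lemma dual_apply_le {R : realType} {V : normedModType R} (f : dual V) x :
  `|f x| <= `|f| * `|x|.
Proof.
have [->|x0] := eqVneq x 0; first by rewrite dual0 !normr0 mulr0.
have nx : 0 < `|x| by rewrite normr_gt0.
have := @dual_norm_ub R V f (`|x|^-1 *: x).
rewrite normrZ normfV normr_id mulVf ?gt_eqF// => /(_ (lexx _)).
by rewrite dualZ normrM normfV normr_id mulrC ler_pdivrMr.
Qed.

(** Pointwise limits along an ultrafilter exist by compactness of segments and
    define a bounded functional on the dual, so reflexivity represents them. *)
Lemma reflexive_ultra_weak_limit {R : realType} {V : normedModType R}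
    (u : nat -> V) (C : R) (G : set_system nat) :
  reflexive_space V -> (forall n, `|u n| <= C) -> UltraFilter G ->
  exists x : V, forall f : dual V, f (u n) @[n --> G] --> f x.
Proof.
move=> Vrefl uC GU.
have fuC (f : dual V) n : `|f (u n)| <= `|f| * C.
  by rewrite (le_trans (dual_apply_le f (u n)))// ler_wpM2l.
have limP (f : dual V) : exists r : R^o, f (u n) @[n --> G] --> r.
  have [|r [_ clr]] := @segment_compact R (- (`|f| * C)) (`|f| * C)
    ((f \o u) @ G) _.
    by apply: (@filterE _ G) => n /=; rewrite in_itv/= -ler_norml.
  exists r => U Ur.
  have [//|GnU] := in_ultra_setVsetC ((f \o u) @^-1` U) GU.
  by have [y [] ] := clr (~` U) U GnU Ur.
have [L LP] := choice limP.
have Lu (f : dual V) r : f (u n) @[n --> G] --> r -> L f = r.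
  by move=> fr; exact: (cvg_unique _ (LP f) fr).
have Ll : linear (L : dual V -> R^o).
  move=> a f g; apply: Lu; rewrite /=.
  have -> : (fun n => (a *: f + g) (u n)) = (fun n => a *: f (u n) + g (u n)) by [].
  by apply: (@cvgD _ _ _ G _ _ _ _ _ (cvgZl_tmp (LP f)) (LP g)).
have [Phi PhiE] : exists Phi : dual (dual V), Phi = L :> (dual V -> R^o).
  apply: (dual_of_bounded L C) => // f; rewrite mulrC.
  apply: (cvgr_to_le (cvg_norm (LP f))).
  by apply: filterE => n; exact: fuC.
have [x xP] := Vrefl Phi; exists x => f.
by rewrite -xP PhiE; exact: LP.
Qed.

Lemma separable_dense_seq {T : ptopologicalType} :
  separable T -> exists a : nat -> T, dense (range a).
Proof.
case=> D /countable_injP[g gi] Dd.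
have [|a aP] := @choice nat T (fun n x => forall y, D y -> g y = n -> x = y).
  move=> n; have [[x [Dx xn]]|nx] := pselect (exists x, D x /\ g x = n).
    by exists x => y Dy yn; apply: gi; rewrite ?inE// xn.
  by exists point => y Dy yn; exfalso; apply: nx; exists y.
exists a => U U0 Uo; have [x [Ux Dx]] := Dd U U0 Uo.
by exists x; split=> //; exists (g x) => //; exact: aP Dx erefl.
Qed.

Lemma dualB {R : realType} {V : normedModType R} (f : dual V) x y :
  f (x - y) = f x - f y.
Proof. by rewrite addrC -scaleN1r dual_linear scaleN1r addrC. Qed.

(** Norming functionals of the points of a dense sequence. *)
Lemma separable_separating_functionals {R : realType} {V : normedModType R} :
  separable V ->
  exists e : nat -> dual V, forall x y, (forall i, e i x = e i y) -> x = y.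
Proof.
move=> /separable_dense_seq[a ad].
have [|e eP] := @choice nat (dual V)
    (fun i f => f (a i) = `|a i| /\ forall y, `|f y| <= `|y|).
  by move=> i; have [f] := norming_functional (a i); exists f.
exists e => x y exy; apply/eqP; rewrite -subr_eq0 -normr_le0 leNgt.
apply/negP => z0; set z := x - y in z0.
have [w [zb [i _ aiE]]] : ball z (`|z| / 2) `&` range a !=set0.
  apply: ad; last exact: ball_open.
  by exists z; apply: ballxx; rewrite divr_gt0.
have [eai ele] := eP i.
have : `|a i| <= `|z - a i|.
  rewrite -eai distrC (le_trans _ (ele _))// dualB.
  by rewrite /z dualB exy subrr subr0 ler_norm.
have := ler_normD (z - a i) (a i); rewrite subrK.
by move: zb; rewrite -ball_normE /= -aiE; lra.
Qed.

(** An ultrafilter limit point [x] is approached, on a separating sequence of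
    functionals, along a subsequence. Any other ultrafilter limit of that
    subsequence agrees with [x] on the separating sequence, so it equals [x]. *)
Theorem bounded_weak_limit_point {R : realType} {V : normedModType R}
    (u : nat -> V) (C : R) :
  reflexive_space V -> separable V -> (forall n, `|u n| <= C) ->
  exists x, weak_limit_point u x.
Proof.
move=> Vrefl /separable_separating_functionals[e esep] uC.
have [G [GU ooG]] := ultraFilterLemma eventually_filter.
have [x xP] := reflexive_ultra_weak_limit u C G Vrefl uC GU.
(* [u (h i)] is close to [x] on the first [i + 1] functionals simultaneously. *)
have [|h hi hP] := subseq_of_frequently
    (fun i n => forall j, (j <= i)%N -> `|e j x - e j (u n)| < i.+1%:R^-1).
  move=> i N.
  suff /filter_ex[n [Nn nP]] : G ([set n | (N <= n)%N] `&`
      [set n | forall j : 'I_i.+1, `|e j x - e j (u n)| < i.+1%:R^-1]).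
    by exists n => // j ji; exact: (nP (Ordinal (ji : (j < i.+1)%N))).
  apply: filterI; first by apply: ooG; exists N.
  apply: filter_forall => j.
  have /(@pseudometric_normed_Zmodule.cvgrPdist_lt _ R^o) := xP (e j).
  by apply; rewrite invr_gt0.
(* Otherwise the values of [f] leave a neighbourhood of [f x] along a further
   subsequence, although its ultrafilter limit [y] equals [x]. *)
exists x, h; split=> // f U Ufx; apply: contrapT => nU.
have freq (i N : nat) : exists2 n, (N <= n)%N & ~ U (f (u (h n))).
  apply: contrapT => nfreq; apply: nU; exists N => // n Nn /=.
  by apply: contrapT => nUn; apply: nfreq; exists n.
have [g gi gP] := subseq_of_frequently (fun _ n => ~ U (f (u (h n)))) freq.
have [y yP] := reflexive_ultra_weak_limit (u \o (h \o g)) C G Vrefl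
  (fun n => uC _) GU.
have xy : x = y.
  apply: esep => j; suff ex : e j (u (h (g n))) @[n --> G] --> e j x.
    by rewrite (cvg_unique _ ex (yP (e j))).
  have : e j (u (h (g n))) @[n --> \oo] --> e j x; last first.
    by move=> + W Wx => /(_ W Wx); exact: ooG.
  apply: (cvg_subseq (fun n => e j (u (h n))) g _ gi).
  apply/cvgrPdist_lt => eps eps0; near=> n.
  apply: (lt_trans (hP n j _)).
    by near: n; exists j.
  by near: n; exact: (near_infty_natSinv_lt (PosNum eps0)).
have /(@filter_ex _ G)[n Un] : G ((fun n => f (u (h (g n)))) @^-1` U).
  by apply: (yP f); rewrite -xy.
exact: gP n Un.
Unshelve. all: by end_near. Qed.

(** * Geometric sums *)

(** In this sum and the next one the terms are geometric and the largest one
    is at most [z], so the sum is at most [a / (a - 1)] times [z]. *)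
Lemma sum_geometric_lt {R : realFieldType} (a z : R) K : 1 < a -> 0 <= z ->
  \sum_(0 <= k < K) (if a ^+ k < z then a ^+ k else 0) <= a / (a - 1) * z.
Proof.
move=> a1 z0; have a0 : 0 < a - 1 by lra.
rewrite mulrAC ler_pdivlMr//; set s := BIG_F.
suff [] : (\sum_(0 <= k < K) s k) * (a - 1) <= a ^+ K /\
  (\sum_(0 <= k < K) s k) * (a - 1) <= a * z by [].
elim: K => [|K [IH1 IH2]].
  by rewrite big_nil mul0r expr0 ler01 mulr_ge0//; lra.
rewrite big_nat_recr//= mulrDl exprS {2 4}/s.
have aK : 0 <= a ^+ K by rewrite exprn_ge0//; lra.
by case: ltP => aKz; split; nra.
Qed.

Lemma sum_geometric_ge {R : realFieldType} (a z : R) K : 1 < a -> 0 <= z ->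
  \sum_(0 <= k < K) (if z <= a ^+ k then z ^+ 2 / a ^+ k else 0) <=
  a / (a - 1) * z.
Proof.
move=> a1 z0; have a0 : 0 < a - 1 by lra.
set s := BIG_F; set c := a / (a - 1).
have c0 : 0 <= c by rewrite divr_ge0//; lra.
(* [z ^+ 2 / a ^+ K * c] is the tail of the series from the index [K] on. *)
suff [small large] : (a ^+ K < z -> \sum_(0 <= k < K) s k = 0) /\
    (z <= a ^+ K -> \sum_(0 <= k < K) s k + z ^+ 2 / a ^+ K * c <= c * z).
  have [/large h|/small ->] := leP z (a ^+ K); last exact: mulr_ge0.
  apply: le_trans h; rewrite lerDl mulr_ge0// divr_ge0 ?sqr_ge0// exprn_ge0//.
  lra.
elim: K => [|K [IH1 IH2]].
  rewrite big_nil expr0 divr1; split=> // z1.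
  by rewrite add0r mulrC ler_wpM2l// expr2; nra.
rewrite big_nat_recr//= {2 4}/s.
have aK : 0 < a ^+ K by rewrite exprn_gt0//; lra.
have [zaK|aKz] := leP z (a ^+ K).
  split=> [|_]; first by move: zaK; rewrite (exprS a); nra.
  apply: le_trans (IH2 zaK); rewrite -addrA lerD2l (exprS a) /c.
  rewrite le_eqVlt; apply/orP; left; apply/eqP; field.
  by rewrite !gt_eqF//; lra.
rewrite IH1// addr0; split=> // zaK; rewrite add0r mulrC ler_wpM2l//.
by rewrite ler_pdivrMr ?expr2 ?ler_wpM2l// exprn_gt0//; lra.
Qed.

Lemma expr_unbounded {R : archiRealFieldType} (a x : R) : 1 < a -> exists k, x < a ^+ k.
Proof.
move=> a1.
have bernoulli k : 1 + k%:R * (a - 1) <= a ^+ k.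
  elim: k => [|k IH]; first by rewrite mul0r addr0 expr0.
  rewrite exprS -natr1; 
  have h : 0 <= k%:R * (a - 1) ^+ 2 :> R by rewrite mulr_ge0 ?sqr_ge0.
  have := ler_wpM2l (ltW (lt_trans ltr01 a1)) IH; apply: le_trans.
  by rewrite -subr_ge0; apply: le_trans h _; rewrite le_eqVlt; apply/orP; left;
    apply/eqP; ring.
exists (Num.truncn (x / (a - 1))).+1.
apply: lt_le_trans (bernoulli _).
have := truncnS_gt (x / (a - 1)); rewrite ltr_pdivrMr; lra.
Qed.

(** * The upper half of the strong law of large numbers *)

Section IndependentSample.
Context {R : realType} {d d' : measure_display} {Omega : measurableType d}
  {T : measurableType d'} {Pr : probability Omega R} {P : probability T R}.
Variable xi : nat -> {RV Pr >-> T}.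
Hypothesis xi_indep : mutually_independent xi.
Hypothesis xi_law : forall i (A : set T), measurable A ->
  distribution Pr (xi i) A = P A.
Local Open Scope ereal_scope.

Lemma sample_pair_law i j (A B : set T) : i != j -> measurable A -> measurable B ->
  Pr (xi i @^-1` A `&` xi j @^-1` B) = P A * P B.
Proof.
move=> ij mA mB; pose C k := if k == i then A else B.
have mC k : measurable (C k) by rewrite /C; case: ifP.
have := xi_indep [fset i; j]%fset C mC.
have -> : \bigcap_(k in [set` [fset i; j]%fset]) xi k @^-1` C k =
    xi i @^-1` A `&` xi j @^-1` B.
  apply/seteqP; split=> [w CW|w [Aw Bw] k /=].
    split.
      by have := CW i; rewrite /C /= eqxx !inE eqxx; exact.
    by have := CW j; rewrite /C /= eq_sym (negPf ij) !inE eqxx orbT; exact.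
  rewrite !inE => /orP[]/eqP ->; rewrite /C ?eqxx//.
  by rewrite eq_sym (negPf ij).
rewrite big_fsetU1/= ?inE// big_seq_fset1.
rewrite /C eqxx [j == i]eq_sym (negPf ij) => ->.
by rewrite -(xi_law i _ mA) -(xi_law j _ mB).
Qed.

Lemma sample_integral i (f : T -> \bar R) :
  measurable_fun setT f -> (forall x, 0 <= f x) ->
  \int[Pr]_w f (xi i w) = \int[P]_x f x.
Proof.
move=> mf f0; rewrite -[LHS](ge0_integral_distribution (xi i) mf f0).
by apply: eq_measure_integral => A mA _; exact: xi_law.
Qed.

(** The joint law of two distinct variables is the product measure, and
    Tonelli's theorem applies. *)
Lemma sample_pair_integral i j (f g : T -> \bar R) : i != j ->
  measurable_fun setT f -> measurable_fun setT g ->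
  (forall x, 0 <= f x) -> (forall x, 0 <= g x) ->
  \int[Pr]_w (f (xi i w) * g (xi j w)) = \int[P]_x f x * \int[P]_x g x.
Proof.
move=> ij mf mg f0 g0.
have mZ : measurable_fun setT (fun w => (xi i w, xi j w)).
  by apply/measurable_fun_pairP; split.
pose Z : {RV Pr >-> (T * T)%type} :=
  HB.pack (fun w => (xi i w, xi j w)) (isMeasurableFun.Build _ _ _ _ _ mZ).
have mfg : measurable_fun setT (fun z : T * T => f z.1 * g z.2).
  by apply: emeasurable_funM; [exact: measurableT_comp mf measurable_fst
    | exact: measurableT_comp mg measurable_snd].
have fg0 (z : T * T) : 0 <= f z.1 * g z.2 by rewrite mule_ge0.
rewrite -[LHS](ge0_integral_distribution Z mfg fg0).
rewrite -(@eq_measure_integral _ _ _ _ (distribution Pr Z) (P \x P)); last first.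
  move=> C mC _; apply: product_measure_unique => // A B mA mB.
  by rewrite -(sample_pair_law i j).
rewrite fubini_tonelli1//; under eq_integral do rewrite /fubini_F/=.
under eq_integral do rewrite ge0_integralZl//.
rewrite ge0_integralZr//.
by apply: integral_ge0.
Qed.

(** Chebyshev's inequality for the sum of [N] pairwise independent variables,
    in the expanded form [N^2 eps^2 1_A + 2 N e S <= S^2 + N^2 e^2], where all
    the terms are nonnegative. *)
Lemma sample_sum_tail (psi : T -> R) (e q eps : R) N :
  measurable_fun setT psi -> (forall x, 0 <= psi x)%R ->
  \int[P]_x (psi x)%:E = e%:E -> \int[P]_x (psi x ^+ 2)%:E = q%:E ->
  (0 < eps)%R -> (0 < N)%N ->
  (N%:R * eps ^+ 2)%:E *
    Pr [set w | N%:R * (e + eps) <= \sum_(0 <= i < N) psi (xi i w)]%R <= q%:E.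
Proof.
move=> mpsi psi0 ePsi qPsi eps0 N0.
pose S w : R := (\sum_(0 <= i < N) psi (xi i w))%R.
have mpsi_xi i : measurable_fun setT (fun w => psi (xi i w)).
  exact: measurableT_comp.
have mS : measurable_fun setT S by exact: measurable_sum.
have S0 w : (0 <= S w)%R by rewrite sumr_ge0.
have mE i : measurable_fun setT (fun w => (psi (xi i w))%:E).
  exact/measurable_EFinP.
have e0 : (0 <= e)%R by rewrite -lee_fin -ePsi; apply: integral_ge0 => x _; rewrite lee_fin.
have intS : \int[Pr]_w (S w)%:E = (N%:R * e)%:E.
  under eq_integral do rewrite -sumEFin.
  rewrite ge0_integral_sum//; last by move=> i w _; rewrite lee_fin.
  rewrite (eq_bigr (fun=> e%:E)); last first.
    by move=> i _; rewrite (sample_integral i (fun x => (psi x)%:E))// ?ePsi//;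
      exact/measurable_EFinP.
  by rewrite sumEFin sumr_const_nat subn0 mulr_natl.
have intSS : \int[Pr]_w (S w ^+ 2)%:E <= (N%:R * q + N%:R ^+ 2 * e ^+ 2)%:E.
  have SS w : (S w ^+ 2)%:E = \sum_(0 <= i < N) \sum_(0 <= j < N)
      (psi (xi i w) * psi (xi j w))%:E.
    under eq_bigr do rewrite sumEFin; rewrite sumEFin expr2; congr EFin.
    by rewrite mulr_suml; apply: eq_bigr => i _; rewrite mulr_sumr.
  have mij i j : measurable_fun setT (fun w => (psi (xi i w) * psi (xi j w))%:E).
    by apply/measurable_EFinP; exact: measurable_funM.
  under eq_integral do rewrite SS.
  rewrite ge0_integral_sum//; last 2 first.
    by move=> i; exact: emeasurable_sum.
    by move=> i w _; rewrite sume_ge0// => j _; rewrite lee_fin mulr_ge0.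
  apply: (@le_trans _ _ (\sum_(0 <= i < N) \sum_(0 <= j < N)
      ((if j == i then q else 0) + e ^+ 2)%:E)).
    apply: lee_sum => i _.
    rewrite ge0_integral_sum//; last by move=> j w _; rewrite lee_fin mulr_ge0.
    apply: lee_sum => j _; have [->|ji] := eqVneq j i.
      under eq_integral do rewrite -expr2.
      rewrite (sample_integral i (fun x => (psi x ^+ 2)%:E))//; last 2 first.
        by apply/measurable_EFinP; exact: measurable_funX.
        by move=> x; rewrite lee_fin sqr_ge0.
      by rewrite qPsi lee_fin lerDl sqr_ge0.
    under eq_integral do rewrite EFinM.
    rewrite (sample_pair_integral i j (fun x => (psi x)%:E) (fun x => (psi x)%:E))
      1?eq_sym//; try by apply/measurable_EFinP.
    by rewrite ePsi add0r -EFinM expr2.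
  under eq_bigr do rewrite sumEFin.
  rewrite sumEFin lee_fin (@eq_big_nat _ _ _ _ _ _ (fun=> q + N%:R * e ^+ 2)%R).
    by rewrite sumr_const_nat subn0 -[(_ *+ N)%R]mulr_natl; lra.
  move=> i iN; rewrite big_split/= sumr_const_nat subn0 -[(_ *+ N)%R]mulr_natl.
  by rewrite -big_mkcond/= big_nat1_eq iN.
set A := [set w | _].
have mA : measurable A.
  rewrite (_ : A = setT `&` S @^-1` `[(N%:R * (e + eps))%R, +oo[).
    exact: (mS measurableT _ (measurable_itv _)).
  by apply/seteqP; split=> w /=; rewrite in_itv/= andbT// => -[].
pose L w := (N%:R ^+ 2 * eps ^+ 2)%:E * (\1_A w)%:E + (2 * N%:R * e)%:E * (S w)%:E.
have mS' : measurable_fun setT (fun w => (S w)%:E) by exact/measurable_EFinP.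
have mS2 : measurable_fun setT (fun w => (S w ^+ 2)%:E).
  by apply/measurable_EFinP; exact: measurable_funX.
have m1A : measurable_fun setT (fun w => (\1_A w)%:E : \bar R).
  by apply/measurable_EFinP; exact: measurable_indic.
have c1 : 0 <= (N%:R ^+ 2 * eps ^+ 2)%:E :> \bar R.
  by rewrite lee_fin mulr_ge0 ?sqr_ge0.
have c2 : 0 <= (2 * N%:R * e)%:E :> \bar R by rewrite lee_fin !mulr_ge0.
have intL : \int[Pr]_w L w =
    (N%:R ^+ 2 * eps ^+ 2)%:E * Pr A + (2 * N%:R * e * (N%:R * e))%:E.
  rewrite /L ge0_integralD//; last 4 first.
  - by move=> w _; rewrite mule_ge0// lee_fin.
  - exact: measurable_funeM.
  - by move=> w _; rewrite mule_ge0// lee_fin.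
  - exact: measurable_funeM.
  rewrite ge0_integralZl//.
  rewrite ge0_integralZl//; last by move=> w _; rewrite lee_fin.
  by rewrite integral_indic// setIT intS -EFinM.
have LS w : L w <= (S w ^+ 2)%:E + (N%:R ^+ 2 * e ^+ 2)%:E.
  rewrite /L -!EFinM -!EFinD lee_fin indicE.
  have -> : (2 * N%:R * e * S w = 2 * (N%:R * e) * S w)%R by rewrite !mulrA.
  rewrite -!exprMn; set n : R := N%:R.
  have [/set_mem/= Aw|_] := boolP (w \in A).
    rewrite mulr1; have : (0 <= n * eps)%R by rewrite mulr_ge0// ltW.
    by move: Aw; rewrite /A/= -/n -/(S w) mulrDr; nra.
  by rewrite mulr0 add0r; have := sqr_ge0 (S w - n * e); nra.
have : \int[Pr]_w L w <= (N%:R * q + N%:R ^+ 2 * e ^+ 2)%:E + (N%:R ^+ 2 * e ^+ 2)%:E.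
  apply: le_trans (leeD2r _ intSS).
  have intc : \int[Pr]_w (cst (N%:R ^+ 2 * e ^+ 2)%:E) w = (N%:R ^+ 2 * e ^+ 2)%:E.
    by rewrite integral_cst//= probability_setT mule1.
  rewrite -[X in _ <= _ + X]intc -ge0_integralD//; last 2 first.
  - by move=> w _; rewrite lee_fin sqr_ge0.
  - by move=> w _; rewrite lee_fin mulr_ge0 ?sqr_ge0.
  apply: ge0_le_integral => //.
  - by move=> w _; rewrite adde_ge0// mule_ge0// lee_fin.
  - by apply: emeasurable_funD; exact: measurable_funeM.
  - exact: emeasurable_funD.
rewrite intL -[Pr A]fineK ?fin_num_measure// -!EFinM -!EFinD !lee_fin.
have n0 : (0 < N%:R :> R)%R by rewrite ltr0n.
move=> H; rewrite -(ler_pM2l n0); lra.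
Qed.

End IndependentSample.

Lemma nneseries_le {R : realType} (f : nat -> \bar R) (c : \bar R) :
  (forall k, 0 <= f k)%E -> (forall K, \sum_(0 <= k < K) f k <= c)%E ->
  (\sum_(0 <= k <oo) f k <= c)%E.
Proof.
move=> f0 fc; apply: lime_le; last exact: nearW.
by apply: is_cvg_nneseries => k _ _; exact: f0.
Qed.

(** Along these times tail probabilities bounded by variances are summable,
    while consecutive times are close enough to interpolate. *)
Definition geometric_size {R : realType} (a : R) k := (Num.truncn (a ^+ k)).+1.

Lemma geometric_size_bounds {R : realType} (a : R) k : 1 < a ->
  a ^+ k < (geometric_size a k)%:R <= a ^+ k + 1.
Proof.
move=> a1; have ak : 0 <= a ^+ k by rewrite exprn_ge0//; lra.
rewrite /geometric_size; have /andP[h1 h2] := truncn_itv ak.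
by rewrite h2 -natr1; lra.
Qed.

Section StrongLaw.
Context {R : realType} {d d' : measure_display} {Omega : measurableType d}
  {T : measurableType d'} {Pr : probability Omega R} {P : probability T R}.
Variable xi : nat -> {RV Pr >-> T}.
Hypothesis xi_indep : mutually_independent xi.
Hypothesis xi_law : forall i (A : set T), measurable A ->
  distribution Pr (xi i) A = P A.
Variables (phi : T -> R) (e : R).
Hypothesis mphi : measurable_fun setT phi.
Hypothesis phi0 : forall x, 0 <= phi x.
Hypothesis ephi : (\int[P]_x (phi x)%:E = e%:E)%E.

Lemma measurable_sum_gt N (c : R) :
  measurable [set w | c < \sum_(0 <= i < N) phi (xi i w)].
Proof.
have mb : measurable_fun setT (fun w => c < \sum_(0 <= i < N) phi (xi i w)).
  apply: measurable_fun_ltr; first exact: measurable_cst.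
  by apply: measurable_sum => i; exact: measurableT_comp.
by rewrite -[X in measurable X]setTI; exact: (mb measurableT [set true]).
Qed.

(** Chebyshev's inequality for the part of the variables below [a ^+ k], and
    a union bound for the part above. *)
Lemma truncated_sum_tail (a eps : R) k : 1 < a -> 0 < eps ->
  (Pr [set w | (geometric_size a k)%:R * (e + eps) <
               \sum_(0 <= i < geometric_size a k) phi (xi i w)]%R <=
   \int[P]_x ((eps ^- 2 * (if phi x <= a ^+ k then phi x ^+ 2 / a ^+ k else 0))%:E
              + (2 * (if a ^+ k < phi x then a ^+ k else 0))%:E))%E.
Proof.
move=> a1 eps0; set N := geometric_size a k.
have /andP[aN Na] : a ^+ k < N%:R <= a ^+ k + 1 := geometric_size_bounds a k a1.
have ak0 : 0 < a ^+ k by rewrite exprn_gt0//; lra.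
have ak1 : 1 <= a ^+ k by rewrite exprn_ege1//; lra.
pose H := [set x | a ^+ k < phi x].
pose psi x := if phi x <= a ^+ k then phi x else 0.
have mle : measurable_fun setT (fun x => phi x <= a ^+ k).
  by apply: measurable_fun_ler => //; exact: measurable_cst.
have mlt : measurable_fun setT (fun x => a ^+ k < phi x).
  by apply: measurable_fun_ltr => //; exact: measurable_cst.
have mpsi : measurable_fun setT psi by apply: measurable_fun_ifT.
have psi0 x : 0 <= psi x by rewrite /psi; case: ifP.
have psia x : psi x <= a ^+ k by rewrite /psi; case: ifP => // _; exact: ltW.
have psiphi x : psi x <= phi x by rewrite /psi; case: ifP.
have mpsiE : measurable_fun setT (EFin \o psi) by exact/measurable_EFinP.
have mpsi2E : measurable_fun setT (fun x => (psi x ^+ 2)%:E).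
  by apply/measurable_EFinP; exact: measurable_funX.
have int_le_e : (\int[P]_x (psi x)%:E <= e%:E)%E.
  rewrite -ephi; apply: ge0_le_integral => //.
  - by move=> x _; rewrite lee_fin.
  - exact/measurable_EFinP.
  - by move=> x _; rewrite lee_fin.
have int2_lty : (\int[P]_x (psi x ^+ 2)%:E < +oo)%E.
  apply: (@le_lt_trans _ _ (\int[P]_x (cst ((a ^+ k) ^+ 2)%:E x))%E).
    apply: ge0_le_integral => //.
    - by move=> x _; rewrite lee_fin sqr_ge0.
    - by move=> x _; rewrite lee_fin ler_pXn2r// nnegrE// ltW.
  by rewrite integral_cst//= probability_setT mule1 ltry.
have psi_fin : (\int[P]_x (psi x)%:E \is a fin_num)%E.
  rewrite ge0_fin_numE ?(le_lt_trans int_le_e) ?ltry//.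
  by apply: integral_ge0 => x _; rewrite lee_fin.
have psi2_fin : (\int[P]_x (psi x ^+ 2)%:E \is a fin_num)%E.
  rewrite ge0_fin_numE//.
  by apply: integral_ge0 => x _; rewrite lee_fin sqr_ge0.
have := sample_sum_tail xi xi_indep xi_law psi _ _ eps N mpsi psi0
  (esym (fineK psi_fin)) (esym (fineK psi2_fin)) eps0 isT.
set ek := fine _; set B := [set w | _ <= _] => PrB.
pose D := \big[setU/set0]_(i < N) (xi i @^-1` H).
have mS (f : T -> R) : measurable_fun setT f ->
    measurable_fun setT (fun w => \sum_(0 <= i < N) f (xi i w)).
  by move=> mf; apply: measurable_sum => i; exact: measurableT_comp.
have mset : measurable H.
  by rewrite -[X in measurable X]setTI; exact: (mlt measurableT [set true]).
have mB : measurable B.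
  have mb : measurable_fun setT (fun w =>
      N%:R * (ek + eps) <= \sum_(0 <= i < N) psi (xi i w)).
    by apply: measurable_fun_ler; [exact: measurable_cst | exact: mS].
  by rewrite -[X in measurable X]setTI; exact: (mb measurableT [set true]).
have mpre i : measurable (xi i @^-1` H).
  by rewrite -[X in measurable X]setTI; exact: measurable_funP.
have mD : measurable D by exact: bigsetU_measurable.
have mA : measurable [set w | N%:R * (e + eps) < \sum_(0 <= i < N) phi (xi i w)].
  exact: measurable_sum_gt.
have AD : [set w | N%:R * (e + eps) < \sum_(0 <= i < N) phi (xi i w)] `<=` B `|` D.
  move=> w /= Aw; have [Dw|nDw] := pselect (D w); [by right|left].
  rewrite /B/=.
  have -> : \sum_(0 <= i < N) psi (xi i w) = \sum_(0 <= i < N) phi (xi i w).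
    apply: eq_big_nat => i /andP[_ iN]; rewrite /psi ifT// leNgt; apply/negP => h.
    by apply: nDw; rewrite /D -(bigcup_mkord N (fun i => xi i @^-1` _)); exists i.
  apply: le_trans (ltW Aw); rewrite ler_wpM2l// lerD2r -lee_fin.
  by rewrite /ek fineK.
have PrD : (Pr D <= (2 * a ^+ k)%:E * P H)%E.
  apply: (le_trans (@Boole_inequality _ _ _ Pr (fun i => xi i @^-1` H) N _)) => //.
  rewrite (eq_bigr (fun=> P H)); last first.
    by move=> i _; rewrite -(xi_law i).
  rewrite -[P H]fineK ?fin_num_measure// sumEFin sumr_const card_ord.
  rewrite -EFinM lee_fin -[(_ *+ N)%R]mulr_natl ler_wpM2r ?fine_ge0//.
  lra.
apply: (@le_trans _ _ (Pr B + Pr D)%E).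
  by apply: le_trans (measureU2 _ mB mD); rewrite le_measure// inE//; exact: measurableU.
have -> : (\int[P]_x ((eps ^- 2 * (if phi x <= a ^+ k then phi x ^+ 2 / a ^+ k else 0))%:E
              + (2 * (if a ^+ k < phi x then a ^+ k else 0))%:E) =
    \int[P]_x ((eps ^- 2 / a ^+ k)%:E * (psi x ^+ 2)%:E
      + (2 * a ^+ k)%:E * (\1_H x)%:E))%E.
  apply: eq_integral => x _; rewrite -!EFinM indicE /psi; congr (_%:E + _%:E)%E.
    by case: ifP => _; rewrite ?mulr0 ?expr0n ?mulr0//; lra.
  have [/set_mem/= ->|/negP h] := boolP (x \in H); first by rewrite mulr1.
  by rewrite ifF ?mulr0//; apply/negP => h'; apply: h; rewrite inE.
have m1 : measurable_fun setT
    (fun x => (\1_H x)%:E : \bar R).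
  by apply/measurable_EFinP; exact: measurable_indic.
have c1 : (0 <= (eps ^- 2 / a ^+ k)%:E)%E.
  by rewrite lee_fin mulr_ge0// invr_ge0 ?sqr_ge0// ltW.
have c2 : (0 <= (2 * a ^+ k)%:E)%E by rewrite lee_fin mulr_ge0// ltW.
rewrite ge0_integralD//; last 4 first.
- by move=> x _; rewrite mule_ge0// lee_fin sqr_ge0.
- exact: measurable_funeM.
- by move=> x _; rewrite mule_ge0// lee_fin.
- exact: measurable_funeM.
rewrite ge0_integralZl//; last by move=> x _; rewrite lee_fin sqr_ge0.
rewrite ge0_integralZl// integral_indic// setIT leeD//.
have e2 : 0 < eps ^+ 2 by rewrite exprn_gt0.
move: PrB; rewrite -[Pr B]fineK ?fin_num_measure//.
rewrite -[X in (_ -> _ <= _ * X)%E]fineK// -!EFinM !lee_fin.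
set b := fine (Pr B) => PrB; have b0 : 0 <= b by rewrite fine_ge0.
rewrite mulrAC ler_pdivlMr// ler_pdivlMl//; apply: le_trans PrB.
rewrite [X in _ <= X](_ : _ = eps ^+ 2 * (b * N%:R)); last by ring.
by rewrite !ler_wpM2l// ltW.
Qed.

(** Summing under the integral sign leaves a multiple of [phi]: at each point
    the bounds of the previous lemma add up to two geometric sums. *)
Lemma truncated_sum_tail_summable (a eps : R) : 1 < a -> 0 < eps ->
  (\sum_(0 <= k <oo) Pr [set w | (geometric_size a k)%:R * (e + eps) <
     \sum_(0 <= i < geometric_size a k) phi (xi i w)]%R < +oo)%E.
Proof.
move=> a1 eps0.
pose g k x := ((eps ^- 2 * (if phi x <= a ^+ k then phi x ^+ 2 / a ^+ k else 0))%:E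
              + (2 * (if a ^+ k < phi x then a ^+ k else 0))%:E)%E.
have a0 : 0 < a by lra.
have g0 k x : (0 <= g k x)%E.
  rewrite /g -EFinD lee_fin addr_ge0// mulr_ge0 ?invr_ge0 ?sqr_ge0//; case: ifP => // _.
    by rewrite divr_ge0 ?sqr_ge0// exprn_ge0// ltW.
  by rewrite exprn_ge0// ltW.
have mg k : measurable_fun setT (g k).
  apply: emeasurable_funD; apply/measurable_EFinP; apply: measurable_funM => //.
    apply: measurable_fun_ifT => //.
      by apply: measurable_fun_ler => //; exact: measurable_cst.
    by apply: measurable_funM => //; exact: measurable_funX.
  apply: measurable_fun_ifT => //.
  by apply: measurable_fun_ltr => //; exact: measurable_cst.
pose C := eps ^- 2 * (a / (a - 1)) + 2 * (a / (a - 1)).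
have C0 : 0 <= C.
  by rewrite addr_ge0// mulr_ge0// ?invr_ge0 ?sqr_ge0// divr_ge0//; lra.
apply: (@le_lt_trans _ _ (C * e)%:E); last exact: ltry.
apply: (@le_trans _ _ (\sum_(0 <= k <oo) \int[P]_x g k x)%E).
  by apply: lee_nneseries => [k _ _|k _]; [exact: measure_ge0|exact: truncated_sum_tail].
rewrite -integral_nneseries// EFinM -ephi -ge0_integralZl//; last 2 first.
- exact/measurable_EFinP.
- by move=> x _; rewrite lee_fin.
apply: ge0_le_integral => //.
- by move=> x _; exact: nneseries_ge0.
- by apply: ge0_emeasurable_sum => // k x _ _; exact: g0.
- by apply: measurable_funeM; exact/measurable_EFinP.
move=> x _; apply: nneseries_le => // K.
rewrite -EFinM (eq_bigr (fun k => (eps ^- 2 *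
    (if phi x <= a ^+ k then phi x ^+ 2 / a ^+ k else 0) +
    2 * (if a ^+ k < phi x then a ^+ k else 0))%:E)); last by [].
rewrite sumEFin lee_fin /C big_split/= -!mulr_sumr [leRHS]mulrDl -(mulrA _ _ (phi x)).
rewrite -(mulrA 2 _ (phi x)); apply: lerD; apply: ler_wpM2l => //.
- by rewrite invr_ge0 sqr_ge0.
- exact: sum_geometric_ge.
- exact: sum_geometric_lt.
Qed.

(** By the Borel-Cantelli lemma, almost every point belongs to finitely many of
    the exceptional sets of the previous lemma. *)
Lemma geometric_sums_ae (a eps : R) : 1 < a -> 0 < eps ->
  {ae Pr, forall w, \forall k \near \oo,
     \sum_(0 <= i < geometric_size a k) phi (xi i w) <=
     (geometric_size a k)%:R * (e + eps)}.
Proof.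
move=> a1 eps0.
pose F k := [set w | (geometric_size a k)%:R * (e + eps) <
  \sum_(0 <= i < geometric_size a k) phi (xi i w)].
have mF k : measurable (F k) by exact: measurable_sum_gt.
exists (lim_sup_set F); split.
- by apply: bigcap_measurable => // n _; exact: bigcup_measurable.
- by apply: lim_sup_set_cvg0 => //; exact: truncated_sum_tail_summable.
move=> w /= nw n _; apply: contrapT => nFw; apply: nw; exists n => // k nk /=.
by rewrite leNgt; apply/negP => Fk; apply: nFw; exists k.
Qed.

(** Since the terms are nonnegative, the sum at a time [n] is at most the sum at
    the next geometric time, at the price of a factor close to the ratio of the
    times, which can be chosen arbitrarily close to 1. *)
Theorem slln_upper :
  {ae Pr, forall w, forall eta, 0 < eta ->
    \forall n \near \oo, \sum_(0 <= i < n) phi (xi i w) <= n%:R * (e + eta)}.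
Proof.
have e0 : 0 <= e by rewrite -lee_fin -ephi; apply: integral_ge0 => x _; rewrite lee_fin.
have fixed eta : 0 < eta -> {ae Pr, forall w, \forall n \near \oo,
    \sum_(0 <= i < n) phi (xi i w) <= n%:R * (e + eta)}.
  (* [del] makes [(1 + 2 * del) * (e + del) <= e + eta]; one [del] is the
     geometric ratio, the other one absorbs the rounding of the times. *)
  move=> eta0; pose del := eta / (3 + 2 * e + eta).
  have den0 : 0 < 3 + 2 * e + eta by lra.
  have del0 : 0 < del by rewrite divr_gt0.
  have delE : del * (3 + 2 * e + eta) = eta by rewrite divfK ?gt_eqF.
  have a1 : 1 < 1 + del by lra.
  apply: filterS (geometric_sums_ae (1 + del) del a1 del0) => w [K _ Kw].
  near=> n.
  have n0 : 1 <= n%:R :> R.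
    by rewrite (ler_nat _ 1); near: n; exact: nbhs_infty_gt.
  have aKn : (1 + del) ^+ K <= n%:R by near: n; exact: nbhs_infty_ger.
  have ndel : 1 <= n%:R * del.
    by rewrite -ler_pdivrMr//; near: n; exact: nbhs_infty_ger.
  have [k nk kmin] := ex_minnP (expr_unbounded (1 + del) n%:R a1).
  case: k => [|k] in nk kmin *; first by move: nk; rewrite expr0 ltNge n0.
  have kn : (1 + del) ^+ k <= n%:R.
    by rewrite leNgt; apply/negP => /kmin; rewrite ltnn.
  have Kk : (K <= k.+1)%N.
    by rewrite -(ler_eXn2l a1) (le_trans aKn)// ltW.
  have /andP[nN Nn] := geometric_size_bounds (1 + del) k.+1 a1.
  have nN' : (n <= geometric_size (1 + del) k.+1)%N.
    by rewrite -(ler_nat R) ltW// (lt_trans nk).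
  apply: (@le_trans _ _ (\sum_(0 <= i < geometric_size (1 + del) k.+1) phi (xi i w))).
    by rewrite (@big_cat_nat _ _ _ n 0 (geometric_size _ _))//= lerDl sumr_ge0.
  apply: (le_trans (Kw k.+1 Kk)); rewrite exprS in Nn.
  apply: (@le_trans _ _ (((1 + del) * n%:R + 1) * (e + del))).
    apply: ler_wpM2r; first by lra.
    by apply: (le_trans Nn); rewrite lerD2r ler_wpM2l//; lra.
  have del1 : del <= 1 by rewrite ler_pdivrMr//; lra.
  apply: (@le_trans _ _ (n%:R * ((1 + 2 * del) * (e + del)))).
    by rewrite mulrA ler_wpM2r//; lra.
  rewrite ler_wpM2l//; nra.
have aeall : {ae Pr, forall w, forall m : nat, \forall n \near \oo,
    \sum_(0 <= i < n) phi (xi i w) <= n%:R * (e + m.+1%:R^-1)}.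
  by apply: ae_foralln => m; apply: fixed; rewrite invr_gt0.
apply: filterS aeall => w aw eta eta0.
have [m _ /(_ m (leqnn m)) /= meta] := near_infty_natSinv_lt (PosNum eta0).
apply: filterS (aw m) => n; move/le_trans; apply.
by rewrite ler_wpM2l// lerD2l ltW.
Unshelve. all: by end_near. Qed.

End StrongLaw.

(** * Partial weak convergence of k-tuples *)

Lemma ereal_real_between {R : realFieldType} (a b : \bar R) :
  (a < b)%E -> exists r : R, (a < r%:E /\ r%:E < b)%E.
Proof.
case: a b => [a| |] [b| |] //; rewrite ?lte_fin => ab.
- by exists ((a + b) / 2); rewrite !lte_fin; split; lra.
- by exists (a + 1); rewrite lte_fin ltry; split => //; lra.
- by exists (b - 1); rewrite lte_fin ltNyr; split => //; lra.
- by exists 0; rewrite ltNyr ltry.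
Qed.

(** The notion of limit for which all sequences of k-tuples are sequentially
    compact: the components outside [J], which have no weak limit, do not
    contribute to the limit of the k-means energy. *)
Definition partial_weak_cvg {R : realType} {X : normedModType R} {k : nat}
    (J : {set 'I_k}) (u : nat -> kprod X k) (l : kprod X k) : Prop :=
  (forall j, j \in J -> weak_cvg (fun n => u n j) (l j)) /\
  (forall j, j \notin J -> `|u n j| @[n --> \oo] --> +oo).

(** The components are treated one after the other: a bounded one has a weakly
    convergent subsequence, an unbounded one a subsequence of norms tending to
    infinity. *)
Lemma partial_weak_cvg_extraction {R : realType} {X : normedModType R} {k : nat}
    (u : nat -> kprod X k) : reflexive_space X -> separable X ->
  exists h J l, increasing_seq h /\ partial_weak_cvg J (u \o h) l.
Proof.
move=> Xrefl Xsep.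
suff [h [J [l [hi [wJ dJ]]]]] : exists h (J : {set 'I_k}) (l : 'I_k -> X),
    increasing_seq h /\
    (forall j, j \in enum 'I_k -> j \in J -> weak_cvg (fun n => u (h n) j) (l j)) /\
    (forall j, j \in enum 'I_k -> j \notin J -> `|u (h n) j| @[n --> \oo] --> +oo).
  exists h, J, [ffun j => l j : X]; split=> //; split=> j jJ.
    by rewrite ffunE; apply: wJ => //; rewrite mem_enum.
  by apply: dJ => //; rewrite mem_enum.
elim: (enum 'I_k) => [|j s [h [J [l [hi [wJ dJ]]]]]].
  by exists id, finset.set0, (fun=> 0).
have keep g : increasing_seq g -> forall i, i \in s ->
    (i \in J -> weak_cvg (fun n => u (h (g n)) i) (l i)) /\
    (i \notin J -> `|u (h (g n)) i| @[n --> \oo] --> +oo).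
  move=> gi i si; split=> [iJ|iJ].
    exact: (weak_cvg_subseq (fun n => u (h n) i) g _ gi (wJ i si iJ)).
  by apply: cvg_comp (dJ i si iJ); exact: increasing_seq_cvg.
have [js|js] := boolP (j \in s).
  exists h, J, l; split=> //; split=> i.
    by rewrite inE => /predU1P[->|si]; exact: wJ.
  by rewrite inE => /predU1P[->|si]; exact: dJ.
have sj i : i \in s -> (i == j) = false.
  by move=> si; apply/negP => /eqP ij; rewrite -ij si in js.
have [[C uC]|nbnd] := pselect (exists C, forall n, `|u (h n) j| <= C).
  have [y [g [gi gy]]] := bounded_weak_limit_point _ _ Xrefl Xsep uC.
  exists (h \o g), (j |: J), (fun i => if i == j then y else l i).
  split; first exact: increasing_seq_comp.
  split=> i; rewrite !inE => /predU1P[->|si]; rewrite ?eqxx ?(sj i si)//=.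
    by move=> iJ; exact: (keep g gi i si).1.
  by move=> iJ; exact: (keep g gi i si).2.
have [|g gi gP] := subseq_of_frequently (fun i n => i%:R <= `|u (h n) j|).
  move=> i N; apply: contrapT => small; apply: nbnd.
  pose C := i%:R + \sum_(n < N) `|u (h n) j|; exists C => n.
  have sum0 : 0 <= \sum_(n < N) `|u (h n) j| by exact: sumr_ge0.
  have [nN|Nn] := ltnP n N.
    rewrite /C (bigD1 (Ordinal nN))//= addrCA lerDl addr_ge0// sumr_ge0//.
  rewrite leNgt; apply/negP => h'; apply: small; exists n => //.
  by apply: le_trans (ltW h'); rewrite lerDl.
exists (h \o g), (J :\ j), l; split; first exact: increasing_seq_comp.
split=> i; rewrite !inE => /predU1P[->|si]; rewrite ?eqxx ?(sj i si)//=.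
- by move=> iJ; exact: (keep g gi i si).1.
- move=> _; apply/cvgryPge => A; near=> n; apply: le_trans (gP n).
  by near: n; exact: nbhs_infty_ger.
- by move=> iJ; exact: (keep g gi i si).2.
Unshelve. all: by end_near. Qed.

Lemma dual_of_linear_le {R : realType} {V W : normedModType R} (f : dual W)
  (L : V -> W) : linear L -> (forall x, `|L x| <= `|x|) ->
  exists g : dual V, forall x, g x = f (L x).
Proof.
move=> Ll Lb.
have [||g gE] := dual_of_bounded (fun x => f (L x)) `|f|.
- by move=> a x y; rewrite Ll dual_linear.
- by move=> x; apply: le_trans (dual_apply_le _ _) _; rewrite ler_wpM2l.
by exists g => x; rewrite gE.
Qed.

(** A functional on k-tuples is a sum of functionals of the components. *)
Lemma weak_cvg_kprodP {R : realType} {X : normedModType R} {k : nat}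
    (u : nat -> kprod X k) l :
  weak_cvg u l <-> forall j, weak_cvg (fun n => u n j) (l j).
Proof.
split=> [ul j f|ul f].
  have [||g gE] := dual_of_linear_le f (fun mu : kprod X k => mu j).
  - by move=> a mu nu; rewrite !ffunE.
  - by move=> mu; exact: (le_bigmax _ (fun j => `|mu j|)).
  have := ul g; rewrite gE.
  by under eq_cvg do rewrite gE.
pose embed (j : 'I_k) (x : X) : kprod X k := [ffun i => if i == j then x else 0].
have [g gE] : exists g : 'I_k -> dual X, forall j x, g j x = f (embed j x).
  have [|g gE] := @choice 'I_k (dual X) (fun j gj => forall x, gj x = f (embed j x)).
    move=> j; apply: dual_of_linear_le.
      move=> a x y; apply/ffunP => i; rewrite !ffunE; case: ifP => // _.
      by rewrite scaler0 addr0.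
    move=> x; apply/bigmax_leP; split=> // i _; rewrite ffunE.
    by case: ifP => // _; rewrite normr0.
  by exists g.
pose L : {linear kprod X k -> R^o} :=
  HB.pack (dual_fun f) (GRing.isLinear.Build _ _ _ _ _ (dual_linear f)).
have fE (mu : kprod X k) : f mu = \sum_j g j (mu j).
  have {1}-> : mu = \sum_j embed j (mu j).
    apply/ffunP => i; rewrite sum_ffunE (bigD1 i)//= big1 ?addr0.
      by rewrite ffunE eqxx.
    by move=> j ji; rewrite ffunE eq_sym (negPf ji).
  rewrite -[LHS]/(L _) linear_sum; apply: eq_bigr => j _.
  by rewrite gE.
rewrite fE; under eq_cvg do rewrite fE.
apply: cvg_big => [|j _]; [exact: add_continuous|exact: ul].
Qed.

(** * Lower semicontinuity of the k-means energy *)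

Lemma limn_einf_ge {R : realType} (a : \bar R) (u : nat -> \bar R) :
  (forall c : R, (c%:E < a)%E -> \forall n \near \oo, (c%:E <= u n)%E) ->
  (a <= limn_einf u)%E.
Proof.
move=> h; rewrite leNgt; apply/negP => /ereal_real_between[c [uc ca]].
have [N _ Nc] := h c ca.
move: uc; apply/negP; rewrite -leNgt.
rewrite (_ : limn_einf u = limf_einf u \oo)// limf_einfE.
apply: ereal_sup_ge; exists (ereal_inf (u @` [set n | (N <= n)%N])).
  by exists [set n | (N <= n)%N] => //; exists N.
by apply: le_ereal_inf_tmp => _ [n /= Nn <-]; exact: Nc.
Qed.

Section MinDist.
Context {R : realType} {X : normedModType R} {k : nat} (d : X -> X -> R).
Implicit Types (J : {set 'I_k}) (mu l : kprod X k) (x : X).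

Definition min_dist_on J x mu : \bar R :=
  \big[mine/+oo%E]_(j < k | j \in J) (d x (mu j))%:E.

Lemma min_dist_onT x mu : min_dist_on [set: 'I_k]%SET x mu = min_dist d x mu.
Proof. by apply: eq_bigl => j; rewrite inE. Qed.

Lemma le_min_dist_onP J x mu (c : \bar R) :
  (c <= min_dist_on J x mu)%E <-> forall j, j \in J -> (c <= (d x (mu j))%:E)%E.
Proof.
split=> [/bigmin_geP[_]//|h]; apply/bigmin_geP; split=> //.
exact: leey.
Qed.

Lemma le_min_distP x mu (c : \bar R) :
  (c <= min_dist d x mu)%E <-> forall j, (c <= (d x (mu j))%:E)%E.
Proof.
rewrite -min_dist_onT le_min_dist_onP; split=> h j; last by move=> _; exact: h.
by apply: h; rewrite inE.
Qed.

Lemma min_dist_on_le J x mu j : j \in J -> (min_dist_on J x mu <= (d x (mu j))%:E)%E.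
Proof. by move=> jJ; exact: (le_min_dist_onP J x mu _).1 (lexx _) j jJ. Qed.

Lemma min_dist_le x mu j : (min_dist d x mu <= (d x (mu j))%:E)%E.
Proof. by rewrite -min_dist_onT min_dist_on_le// inE. Qed.

Lemma min_dist_le_on J x mu : (min_dist d x mu <= min_dist_on J x mu)%E.
Proof. by apply/le_min_dist_onP => j _; exact: min_dist_le. Qed.

Hypothesis d_ge0 : forall x y, 0 <= d x y.

Lemma min_dist_on_ge0 J x mu : (0 <= min_dist_on J x mu)%E.
Proof. by apply/le_min_dist_onP => j _; rewrite lee_fin. Qed.

Lemma min_dist_ge0 x mu : (0 <= min_dist d x mu)%E.
Proof. by rewrite -min_dist_onT min_dist_on_ge0. Qed.

Hypothesis d_meas : forall y : X,
  measurable_fun [set: borel X] (fun x : borel X => d x y).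

Lemma measurable_min_dist_on J mu :
  measurable_fun [set: borel X] (fun x : borel X => min_dist_on J x mu).
Proof.
rewrite /min_dist_on; elim: (index_enum _) => [|j s IH].
  by under eq_fun do rewrite big_nil; exact: measurable_cst.
have [jJ|/negPf jJ] := boolP (j \in J); under eq_fun do rewrite big_cons jJ;
  last exact: IH.
have mdj : measurable_fun [set: borel X] (fun x : borel X => (d x (mu j))%:E).
  by apply/measurable_EFinP; exact: d_meas.
exact: measurable_mine mdj IH.
Qed.

Lemma measurable_min_dist mu :
  measurable_fun [set: borel X] (fun x : borel X => min_dist d x mu).
Proof.
by under eq_fun do rewrite -min_dist_onT; exact: measurable_min_dist_on.
Qed.

Hypothesis d_lsc : forall (x y : X) (xs ys : nat -> X),
     xs n @[n --> \oo] --> x -> weak_cvg ys y ->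
     ((d x y)%:E <= limf_einf (fun p : nat * nat => (d (xs p.1) (ys p.2))%:E)
                              (filter_prod \oo \oo))%E.

(** Joint lower semicontinuity along a fixed weakly convergent sequence is
    uniform on a neighbourhood of [x], by extracting a diagonal sequence of
    counterexamples. *)
Lemma near_le_dist_weak_cvg x y (ys : nat -> X) (c : R) :
  weak_cvg ys y -> c < d x y ->
  \forall z \near x & n \near \oo, c <= d z (ys n).
Proof.
move=> ysy cd; apply: contrapT => nnear.
have bad i : exists zn : X * nat,
    [/\ ball x i.+1%:R^-1 zn.1, (i <= zn.2)%N & d zn.1 (ys zn.2) < c].
  apply: contrapT => nbad; apply: nnear.
  exists (ball x i.+1%:R^-1, [set n | (i <= n)%N]) => /=.
    by split; [exact: nbhsx_ballx | exists i].
  move=> [z n] /= [bz iz]; rewrite leNgt; apply/negP => dz.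
  by apply: nbad; exists (z, n).
have [zn znP] := choice bad.
have zx : (zn i).1 @[i --> \oo] --> x.
  apply/(@pseudometric_normed_Zmodule.cvgrPdist_lt _ X) => eps eps0; near=> i.
  have [bz _ _] := znP i; move: bz; rewrite -ball_normE /= => /lt_trans; apply.
  by near: i; exact: (near_infty_natSinv_lt (PosNum eps0)).
have := d_lsc x y (fun i => (zn i).1) ys zx ysy.
apply/negP; rewrite -ltNge limf_einfE.
apply: (@le_lt_trans _ _ c%:E); last by rewrite lte_fin.
apply: ge_ereal_sup => _ [V [[A B] /= [[a _ Aa] [b _ Bb]] ABV] <-].
have [_ ib dc] := znP (maxn a b).
apply: (@le_trans _ _ (d (zn (maxn a b)).1 (ys (zn (maxn a b)).2))%:E); last first.
  by rewrite lee_fin ltW.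
apply: ereal_inf_lbound; exists (maxn a b, (zn (maxn a b)).2) => //.
apply: ABV; split=> /=; first by apply: Aa => /=; exact: leq_maxl.
by apply: Bb => /=; apply: leq_trans ib; exact: leq_maxr.
Unshelve. all: by end_near. Qed.

Variable m : R -> R.
Hypothesis m_infty : m r @[r --> +oo] --> +oo.
Hypothesis d_ge_m : forall x y, m `|x - y| <= d x y.

Lemma near_le_dist_infty x (ys : nat -> X) (c : R) :
  `|ys n| @[n --> \oo] --> +oo ->
  \forall z \near x & n \near \oo, c <= d z (ys n).
Proof.
move=> ysoo.
have [r [_ rm]] : \forall r \near +oo, c <= m r.
  by have /cvgryPge := m_infty; exact.
exists (ball x 1, [set n | `|x| + 1 + `|r| + 1 <= `|ys n|]) => /=.
  split; first exact: nbhsx_ballx.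
  by have /cvgryPge := ysoo; exact.
move=> [z n] /= [bz big]; apply: le_trans (d_ge_m _ _); apply: rm.
move: bz; rewrite -ball_normE /= => bz.
have h1 : `|ys n| <= `|z - ys n| + `|z|.
  by have := ler_normB z (z - ys n); rewrite subKr; lra.
have h2 : `|z| <= `|x| + `|x - z|.
  by have := ler_normB x (x - z); rewrite subKr; lra.
have := ler_norm r; lra.
Qed.

(** The two cases are those of the previous two lemmas, according to whether a
    component belongs to [J]. *)
Lemma near_le_min_dist J x l (u : nat -> kprod X k) (c : R) :
  partial_weak_cvg J u l -> (c%:E < min_dist_on J x l)%E ->
  \forall z \near x & n \near \oo, (c%:E <= min_dist d z (u n))%E.
Proof.
move=> [wJ dJ] cJ.
suff : \forall p \near filter_prod (nbhs x) \oo,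
    forall j : 'I_k, c <= d p.1 (u p.2 j).
  apply: filterS => -[z n] /= h; apply/le_min_distP => j.
  by rewrite lee_fin.
apply: filter_forall => j; have [jJ|jJ] := boolP (j \in J).
  apply: (near_le_dist_weak_cvg x (l j) (fun n => u n j)); first exact: wJ.
  by rewrite -lte_fin (lt_le_trans cJ)// min_dist_on_le.
apply: (near_le_dist_infty x (fun n => u n j)); exact: dJ.
Qed.

Lemma min_dist_limn_einf J x l (u : nat -> kprod X k) :
  partial_weak_cvg J u l ->
  (min_dist_on J x l <= limn_einf (fun n => min_dist d x (u n)))%E.
Proof.
move=> uJ; apply: limn_einf_ge => c cJ.
have [[U V] /= [Ux Voo] UV] := near_le_min_dist J x l u c uJ cJ.
by apply: filterS Voo => n Vn; apply: (UV (x, n)); split=> //; exact: nbhs_singleton.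
Qed.

Hypothesis X_reflexive : reflexive_space X.
Hypothesis X_separable : separable X.

(** The direct method. Components of a minimizing sequence that escape to
    infinity are replaced by arbitrary points, which only decreases the
    energy. *)
Theorem kmeans_minimizer (Q : {measure set (borel X) -> \bar R}) :
  exists mu : kprod X k, is_minimizer
    (fun mu : kprod X k => \int[Q]_(x in [set: borel X]) min_dist d x mu)%E mu.
Proof.
pose F (mu : kprod X k) := (\int[Q]_(x in [set: borel X]) min_dist d x mu)%E.
have [|v vF vlim] := @ereal_inf_seq R (range F).
  by apply/set0P; exists (F 0), 0.
have [u uF] : exists u : nat -> kprod X k, forall n, F (u n) = v n.
  have [|u uF] := @choice nat (kprod X k) (fun n mu => F mu = v n).
    by move=> n; have [mu _] := vF n; exists mu.
  by exists u.
have [h [J [l [hi uJ]]]] := partial_weak_cvg_extraction u X_reflexive X_separable.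
exists l => mu.
have Fmu : (ereal_inf (range F) <= F mu)%E by apply: ereal_inf_lbound; exists mu.
apply: le_trans Fmu.
have -> : ereal_inf (range F) = limn_einf (fun n => F (u (h n))).
  have vh := cvg_subseq v h _ hi vlim.
  rewrite (_ : (fun n => F (u (h n))) = (fun n => v (h n))); last first.
    by apply/funext => n; rewrite uF.
  by rewrite (cvg_limn_einf_sup vh).
apply: le_trans (fatou Q measurableT _ _) => //=; last 2 first.
- by move=> n; exact: measurable_min_dist.
- by move=> n x _; exact: min_dist_ge0.
apply: ge0_le_integral => //.
- by move=> x _; exact: min_dist_ge0.
- exact: measurable_min_dist.
- apply: measurableT_comp => //.
  apply: measurable_fun_limn_esup => n.
  by apply: measurableT_comp => //; exact: measurable_min_dist.
- move=> x _; apply: le_trans (min_dist_le_on J x l) _.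
  exact: min_dist_limn_einf uJ.
Qed.

End MinDist.

(** * A Portmanteau argument along varying integrands *)

Section Steps.
Context {R : realType} {X : normedModType R} (a : nat -> X).

Definition basic_ball (b : nat * nat) : set X := ball (a b.1) (b.2.+1%:R^-1 : R).

Lemma basic_ball_sub (x : X) (U : set X) : dense (range a) -> nbhs x U ->
  exists b, basic_ball b x /\ basic_ball b `<=` U.
Proof.
move=> ad /nbhs_ballP[r /= r0 rU].
have [p _ /(_ p (leqnn p)) /= pr] :=
  near_infty_natSinv_lt (PosNum (divr_gt0 r0 (ltr0n R 2))).
have [||w [bx [i _ aiw]]] := ad (ball x p.+1%:R^-1).
- by exists x; apply: ballxx; rewrite invr_gt0.
- exact: ball_open.
rewrite -aiw in bx; exists (i, p); split; first exact: ball_sym.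
move=> z bz; apply: rU; have -> : r = r / 2 + r / 2 by lra.
apply: (@ball_triangle _ _ (a i)).
  by apply: (le_ball _ bx); exact: ltW.
by apply: (le_ball _ bz); exact: ltW.
Qed.

(** When [a] is dense, every nonnegative lower semicontinuous function is an
    increasing limit of functions of this countable family. *)
Definition step_max (s : seq ((nat * nat) * rat)) (x : X) : R :=
  \big[Num.max/0]_(i <- s) (ratr i.2 * \1_(basic_ball i.1) x).

Lemma step_max_ge0 s x : 0 <= step_max s x.
Proof. exact: bigmax_ge_id. Qed.

Lemma step_max_bounded s : exists C : R, forall x, step_max s x <= C.
Proof.
exists (\big[Num.max/0]_(i <- s) `|ratr i.2|) => x.
rewrite /step_max !big_seq; apply: bigmax_le => [|i si]; first exact: bigmax_ge_id.
apply: le_trans (le_bigmax_seq 0 i (fun i => i \in s) (fun i => `|ratr i.2|) si si).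
rewrite indicE; case: (x \in _); first by rewrite mulr1 ler_norm.
by rewrite mulr0.
Qed.

Lemma measurable_step_max s : measurable_fun [set: borel X] (step_max s : borel X -> R).
Proof.
rewrite /step_max; elim: s => [|i s IH].
  by under eq_fun do rewrite big_nil; exact: measurable_cst.
under eq_fun do rewrite big_cons.
have mi : measurable_fun [set: borel X]
    (fun x : borel X => ratr i.2 * \1_(basic_ball i.1) x : R).
  apply: measurable_funM; first exact: measurable_cst.
  apply: measurable_indic; apply: sub_sigma_algebra; exact: ball_open.
exact: measurable_maxr mi IH.
Qed.

End Steps.

Section GammaLiminf.
Context {R : realType} {X : normedModType R} {k : nat} (d : X -> X -> R).
Hypothesis d_ge0 : forall x y, 0 <= d x y.
Hypothesis d_meas : forall y : X,
  measurable_fun [set: borel X] (fun x : borel X => d x y).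
Hypothesis d_lsc : forall (x y : X) (xs ys : nat -> X),
     xs n @[n --> \oo] --> x -> weak_cvg ys y ->
     ((d x y)%:E <= limf_einf (fun p : nat * nat => (d (xs p.1) (ys p.2))%:E)
                              (filter_prod \oo \oo))%E.
Variable m : R -> R.
Hypothesis m_infty : m r @[r --> +oo] --> +oo.
Hypothesis d_ge_m : forall x y, m `|x - y| <= d x y.
Variable a : nat -> X.
Hypothesis a_dense : dense (range a).
Variables (P : {measure set (borel X) -> \bar R})
  (Q : nat -> {measure set (borel X) -> \bar R}).
Hypothesis PQ : forall s (c : R),
  (c%:E < \int[P]_x (step_max a s x)%:E)%E ->
  \forall n \near \oo, (c%:E <= \int[Q n]_x (step_max a s x)%:E)%E.

(** The steps that lie eventually below [min_dist _ (u n)] have a supremum at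
    least equal to the limit integrand, by joint lower semicontinuity; finitely
    many of them carry almost all of its integral. *)
Theorem kmeans_gamma_liminf (J : {set 'I_k}) (u : nat -> kprod X k) l h (c : R) :
  increasing_seq h -> partial_weak_cvg J u l ->
  (c%:E < \int[P]_x min_dist_on d J x l)%E ->
  \forall n \near \oo, (c%:E <= \int[Q (h n)]_x min_dist d x (u n))%E.
Proof.
move=> hi uJ cJ.
pose below (i : (nat * nat) * rat) := \forall n \near \oo, forall x,
  ((ratr i.2 * \1_(basic_ball a i.1) x)%:E <= min_dist d x (u n))%E.
(* The valid steps among the first [K] ones of an enumeration. *)
pose s K := [seq i <- pmap (fun n => choice.unpickle n : option ((nat * nat) * rat))
  (iota 0 K) | `[< below i >]].
have s_below K i : i \in s K -> below i.
  by rewrite mem_filter => /andP[/asboolP].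
have s_mem K i : below i -> (choice.pickle i < K)%N -> i \in s K.
  move=> bi iK; rewrite mem_filter asboolT//= mem_pmap; apply/mapP.
  by exists (choice.pickle i); rewrite ?choice.pickleK// mem_iota.
have s_sub K K' i : (K <= K')%N -> i \in s K -> i \in s K'.
  move=> KK'; rewrite !mem_filter => /andP[-> /=]; rewrite !mem_pmap.
  move=> /mapP[j]; rewrite mem_iota => /andP[_ jK] jE; apply/mapP; exists j => //.
  by rewrite mem_iota (leq_trans jK).
have step_nd x : {homo (fun K => (step_max a (s K) x)%:E) :
    K K' / (K <= K')%N >-> (K <= K')%E}.
  move=> K K' KK'; rewrite lee_fin {1}/step_max big_seq.
  apply: bigmax_le => [|i si]; first exact: step_max_ge0.
  exact: (le_bigmax_seq 0 i xpredT (fun i => ratr i.2 * \1_(basic_ball a i.1) x)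
    (s_sub K K' i KK' si)).
have step_cvg x : cvgn (fun K => (step_max a (s K) x)%:E).
  exact: ereal_nondecreasing_is_cvgn.
have step_sup x : (min_dist_on d J x l <= limn (fun K => (step_max a (s K) x)%:E))%E.
  rewrite leNgt; apply/negP => /ereal_real_between[r [lim_r]].
  move=> /ereal_real_between[r' [rr' r'J]].
  have [q] := rat_in_itvoo rr'.
  rewrite in_itv/= => /andP[rq qr'].
  have qJ : ((ratr q)%:E < min_dist_on d J x l)%E by rewrite (lt_trans _ r'J)// lte_fin.
  have [[U V] /= [Ux Voo] UV] := near_le_min_dist d d_lsc m m_infty d_ge_m J x l u
    (ratr q) uJ qJ.
  have [b [bx bU]] := basic_ball_sub a x U a_dense Ux.
  have bq : below (b, q).
    apply: filterS Voo => n Vn z /=; rewrite indicE.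
    have [/set_mem zb|_] := boolP (z \in _); last by rewrite mulr0 min_dist_ge0.
    by rewrite mulr1; apply: (UV (z, n)); split=> //; exact: bU.
  move: lim_r; apply/negP; rewrite -leNgt.
  apply: (@le_trans _ _ (step_max a (s (choice.pickle (b, q)).+1) x)%:E); last first.
    apply: lime_ge => //; exists (choice.pickle (b, q)).+1 => // K; exact: step_nd.
  rewrite lee_fin; apply: (le_trans (ltW rq)).
  have := le_bigmax_seq 0 (b, q) xpredT (fun i => ratr i.2 * \1_(basic_ball a i.1) x : R)
    (s_mem _ (b, q) bq (ltnSn _)) isT.
  by rewrite /= indicE mem_set// mulr1.
have [K cK] : exists K, (c%:E < \int[P]_x (step_max a (s K) x)%:E)%E.
  apply: contrapT => nK.
  have : (\int[P]_x min_dist_on d J x l <= c%:E)%E; last by rewrite leNgt cJ.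
  have mstep n : measurable_fun [set: borel X] (fun x : borel X => (step_max a (s n) x)%:E).
    by apply/measurable_EFinP; exact: measurable_step_max.
  apply: (@le_trans _ _ (\int[P]_x limn (fun K => (step_max a (s K) x)%:E))%E).
    apply: ge0_le_integral => //.
    - by move=> x _; exact: min_dist_on_ge0.
    - exact: measurable_min_dist_on.
    - apply: (@emeasurable_fun_cvg _ _ _ _
        (fun n (x : borel X) => (step_max a (s n) x)%:E)).
        exact: mstep.
      by move=> x _; exact: step_cvg.
  rewrite monotone_convergence//; last by move=> n x _; rewrite lee_fin step_max_ge0.
  apply: lime_le.
    apply: ereal_nondecreasing_is_cvgn => n n' nn'.
    apply: ge0_le_integral => //.
    - by move=> x _; rewrite lee_fin step_max_ge0.
    - by move=> x _; exact: step_nd.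
  by apply: nearW => n; rewrite leNgt; apply/negP => cn; apply: nK; exists n.
have s_near : \forall n \near \oo, forall x, ((step_max a (s K) x)%:E <= min_dist d x (u n))%E.
  have : \forall n \near \oo, forall i, i \in s K -> forall x,
    ((ratr i.2 * \1_(basic_ball a i.1) x)%:E <= min_dist d x (u n))%E.
    elim: (s K) (s_below K) => [|i t IH] below_t; first exact: nearW.
    have it : forall j, j \in t -> below j.
      by move=> j jt; apply: below_t; rewrite inE jt orbT.
    apply: filterS2 (below_t i (mem_head _ _)) (IH it) => n hi' ht j.
    by rewrite inE => /predU1P[->|/ht].
  apply: filterS => n hn x; apply/le_min_distP => j; rewrite lee_fin.
  rewrite /step_max big_seq; apply: bigmax_le => // i si.
  by rewrite -lee_fin; apply: le_trans (min_dist_le d x (u n) j); exact: hn.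
have := increasing_seq_cvg h hi _ (PQ (s K) c cK).
apply: filterS2 s_near => n sn /le_trans; apply.
apply: ge0_le_integral => //.
- by move=> x _; rewrite lee_fin step_max_ge0.
- by apply/measurable_EFinP; exact: measurable_step_max.
- exact: measurable_min_dist.
Qed.

End GammaLiminf.

(** * Empirical measures *)

Section Empirical.
Context {R : realType} {d : measure_display} {T : measurableType d}.

Definition empirical_measure (n : nat) (x : nat -> T) : {measure set T -> \bar R} :=
  mscale (n%:R^-1)%:nng (msum (fun i => \d_(x i)) n).

Lemma integral_empirical n (x : nat -> T) (f : T -> \bar R) :
  measurable_fun setT f -> (forall t, (0 <= f t)%E) ->
  (\int[empirical_measure n x]_t f t = (n%:R^-1)%:E * \sum_(0 <= i < n) f (x i))%E.
Proof.
move=> mf f0; rewrite ge0_integral_mscale//= ge0_integral_measure_sum//.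
rewrite big_mkord; congr (_ * _)%E; apply: eq_bigr => i _.
by rewrite integral_dirac// diracT mul1e.
Qed.

End Empirical.

Section EmpiricalSteps.
Context {R : realType} {X : normedModType R} {d : measure_display}
  {Omega : measurableType d} {Pr : probability Omega R}
  {P : probability (borel X) R}.
Variable xi : nat -> {RV Pr >-> borel X}.
Hypothesis xi_indep : mutually_independent xi.
Hypothesis xi_law : forall i (A : set (borel X)), measurable A ->
  distribution Pr (xi i) A = P A.

(** The upper half of the strong law applied to [C - phi]. *)
Lemma slln_lower (phi : borel X -> R) (C : R) :
  measurable_fun setT phi -> (forall x, 0 <= phi x) -> (forall x, phi x <= C) ->
  {ae Pr, forall w, forall c, (c%:E < \int[P]_x (phi x)%:E)%E ->
    \forall n \near \oo,
      (c%:E <= \int[empirical_measure n (fun i => xi i w)]_x (phi x)%:E)%E}.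
Proof.
move=> mphi phi0 phiC.
have mE : measurable_fun setT (fun x => (phi x)%:E) by exact/measurable_EFinP.
have intC : (\int[P]_x (cst C%:E) x = C%:E)%E.
  by rewrite integral_cst//= probability_setT mule1.
have efin : (\int[P]_x (phi x)%:E \is a fin_num)%E.
  rewrite ge0_fin_numE; last by apply: integral_ge0 => x _; rewrite lee_fin.
  apply: (@le_lt_trans _ _ C%:E); last exact: ltry.
  rewrite -intC; apply: ge0_le_integral => //.
  - by move=> x _; rewrite lee_fin.
  - by move=> x _; rewrite lee_fin.
set e := (\int[P]_x (phi x)%:E)%E in efin *.
have mC : measurable_fun setT (fun x => C - phi x).
  by apply: measurable_funB => //; exact: measurable_cst.
have C0 x : 0 <= C - phi x by rewrite subr_ge0.
have eC : (\int[P]_x (C - phi x)%:E = (C - fine e)%:E)%E.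
  have : (\int[P]_x (C - phi x)%:E + e = C%:E)%E.
    rewrite /e -ge0_integralD//.
    - rewrite -[RHS]intC; apply: eq_integral => x _.
      by rewrite -EFinD subrK.
    - by move=> x _; rewrite lee_fin.
    - exact/measurable_EFinP.
    - by move=> x _; rewrite lee_fin.
  rewrite -[e in LHS]fineK// EFinB => <-.
  by rewrite addeK// fineK.
apply: filterS (slln_upper xi xi_indep xi_law _ _ mC C0 eC) => w slln c.
rewrite -/e -(fineK efin) lte_fin => ce.
have [|N _ NP] := slln (fine e - c); first by rewrite subr_gt0.
exists N.+1 => // n /= Nn; have := NP n (ltnW Nn).
have n0 : 0 < n%:R :> R by rewrite ltr0n (leq_trans _ Nn).
rewrite integral_empirical//.
rewrite sumEFin -EFinM lee_fin ler_pdivlMl// big_split/= sumr_const_nat subn0.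
rewrite sumrN -[(_ *+ n)%R]mulr_natl; lra.
Qed.

Lemma empirical_steps_ae (a : nat -> X) :
  {ae Pr, forall w, forall s c, (c%:E < \int[P]_x (step_max a s x)%:E)%E ->
    \forall n \near \oo,
      (c%:E <= \int[empirical_measure n (fun i => xi i w)]_x (step_max a s x)%:E)%E}.
Proof.
have step_ae s : {ae Pr, forall w, forall c, (c%:E < \int[P]_x (step_max a s x)%:E)%E ->
    \forall n \near \oo,
      (c%:E <= \int[empirical_measure n (fun i => xi i w)]_x (step_max a s x)%:E)%E}.
  have [C sC] := step_max_bounded a s.
  by apply: (slln_lower _ C) => //; [exact: measurable_step_max|exact: step_max_ge0].
have := ae_foralln (fun i => step_ae (odflt [::] (choice.unpickle i))).
apply: filterS => w hw s; have := hw (choice.pickle s).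
by rewrite choice.pickleK.
Qed.

End EmpiricalSteps.

(** * Every centre is useful *)

Section Strictness.
Context {R : realType} {X : normedModType R} {k : nat} (d : X -> X -> R).
Hypothesis d_ge0 : forall x y, 0 <= d x y.
Hypothesis d_meas : forall y : X,
  measurable_fun [set: borel X] (fun x : borel X => d x y).
Variables m M : R -> R.
Hypothesis m_ge0 : forall r : R, 0 <= r -> 0 <= m r.
Hypothesis m_incr : forall r s : R, 0 <= r -> r < s -> m r < m s.
Hypothesis M_cont : {within `[0, +oo[, continuous M}.
Hypothesis M0 : M 0 = 0.
Hypothesis d_bounds : forall x y : X, m `|x - y| <= d x y /\ d x y <= M `|x - y|.
Variable P : probability (borel X) R.
Variable p : 'I_k -> X.
Hypothesis p_inj : injective p.
Hypothesis p_support :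
  forall (delta : R) (j : 'I_k), 0 < delta -> (0 < P (ball (p j) delta))%E.

(** Fewer than [k] centres cannot occupy [k] distinct points. *)
Lemma unused_point (J : {set 'I_k}) (l : 'I_k -> X) j0 : j0 \notin J ->
  exists i, forall j, j \in J -> p i != l j.
Proof.
move=> j0J; apply: contrapT => nex.
have [|g gP] := @choice 'I_k 'I_k (fun i j => j \in J /\ p i = l j).
  move=> i; apply: contrapT => nj; apply: nex; exists i => j jJ.
  by apply/eqP => pl; apply: nj; exists j.
have g_inj : injective g.
  by move=> i i' gii'; apply: p_inj; rewrite (gP i).2 (gP i').2 gii'.
have /codomP[i j0E] := injF_onto g_inj j0.
by move: j0J; rewrite j0E (gP i).1.
Qed.

(** A centre placed at a point of the support away from the other centres
    lowers the energy by a fixed amount on a ball of positive measure. *)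
Lemma min_dist_on_improvable (J : {set 'I_k}) (l : kprod X k) j0 : j0 \notin J ->
  (\int[P]_x min_dist_on d J x l < +oo)%E ->
  exists mu : kprod X k,
    (\int[P]_x min_dist d x mu < \int[P]_x min_dist_on d J x l)%E.
Proof.
move=> j0J Jfin; have [i0 i0J] := unused_point J l j0 j0J.
pose r := \big[Num.min/1]_(j < k | j \in J) `|p i0 - l j|.
have r0 : 0 < r.
  by apply/bigmin_gtP; split=> // j jJ; rewrite normr_gt0 subr_eq0 i0J.
have rl j : j \in J -> r <= `|p i0 - l j| by move=> jJ; exact: bigmin_le_cond.
(* Near [p i0] the old centres are at distance at least [r / 2], so they cost
   at least [2 * eta], while the new centre costs less than [eta]. *)
pose eta := m (r / 2) / 2.
have eta0 : 0 < eta.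
  by rewrite divr_gt0// (le_lt_trans (m_ge0 0 (lexx _)))// m_incr// divr_gt0.
have [del [del0 delr Mdel]] : exists del, [/\ 0 < del, del <= r / 2 &
    forall s, 0 <= s -> s < del -> M s < eta].
  have [_ MC] := (continuous_within_itvcyP 0 M).1 M_cont.
  have /(@pseudometric_normed_Zmodule.cvgrPdist_lt _ R^o) := MC.
  rewrite M0 => /(_ eta eta0) [e /= e0 eM].
  exists (Num.min e (r / 2)); split; first by rewrite lt_min e0 divr_gt0.
    by rewrite ge_min lexx orbT.
  move=> s; rewrite le_eqVlt => /predU1P[<- _|s0]; first by rewrite M0.
  rewrite lt_min => /andP[se _].
  have : `|0 - M s| < eta by apply: eM => //=; rewrite sub0r normrN gtr0_norm.
  by rewrite sub0r normrN; apply: le_lt_trans; exact: ler_norm.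
pose mu : kprod X k := [ffun j => if j == j0 then p i0 else l j].
pose B : set (borel X) := ball (p i0) del.
have mB : measurable B by apply: sub_sigma_algebra; exact: ball_open.
have PB : (0 < P B)%E by exact: p_support.
have mu_le x : (min_dist d x mu + (eta * \1_B x)%:E <= min_dist_on d J x l)%E.
  apply/le_min_dist_onP => j jJ; rewrite indicE.
  have [/set_mem Bx|_] := boolP (x \in B); last first.
    rewrite mulr0 adde0; apply: le_trans (min_dist_le d x mu j) _.
    by rewrite ffunE ifF//; apply/negP => /eqP jj0; rewrite -jj0 jJ in j0J.
  move: Bx; rewrite /B -ball_normE /= => xp.
  apply: (@le_trans _ _ (eta%:E + eta%:E)%E); last first.
    rewrite -EFinD lee_fin /eta -splitr; apply: le_trans (d_bounds x (l j)).1.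
    have : r / 2 <= `|x - l j|.
      by have := ler_distD x (p i0) (l j); have := rl j jJ; lra.
    rewrite le_eqVlt => /predU1P[->//|/m_incr h]; rewrite ltW// h//.
    by rewrite divr_ge0// ltW.
  rewrite mulr1 leeD2r//; apply: le_trans (min_dist_le d x mu j0) _.
  rewrite ffunE eqxx lee_fin; apply: le_trans (d_bounds x (p i0)).2 _.
  by rewrite distrC ltW// Mdel.
have int_le : (\int[P]_x min_dist d x mu + (eta%:E * P B) <=
    \int[P]_x min_dist_on d J x l)%E.
  have -> : (eta%:E * P B = \int[P]_x (eta * \1_B x)%:E)%E.
    under eq_integral do rewrite EFinM.
    rewrite ge0_integralZl//; last by rewrite lee_fin ltW.
      by rewrite integral_indic// setIT.
    by apply/measurable_EFinP; exact: measurable_indic.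
  have m1 : measurable_fun [set: borel X] (fun x => (eta * \1_B x)%:E).
    apply/measurable_EFinP; apply: measurable_funM; first exact: measurable_cst.
    exact: measurable_indic.
  have e1 x : (0 <= (eta * \1_B x)%:E)%E by rewrite lee_fin mulr_ge0// ltW.
  rewrite -ge0_integralD//; last 2 first.
  - by move=> x _; exact: min_dist_ge0.
  - exact: measurable_min_dist.
  apply: ge0_le_integral => //.
  - by move=> x _; rewrite adde_ge0// min_dist_ge0.
  - by apply: emeasurable_funD => //; exact: measurable_min_dist.
  - exact: measurable_min_dist_on.
exists mu; apply: (lt_le_trans _ int_le).
have fin_mu : (\int[P]_x min_dist d x mu \is a fin_num)%E.
  rewrite ge0_fin_numE; last by apply: integral_ge0 => x _; exact: min_dist_ge0.
  apply: le_lt_trans Jfin; apply: le_trans int_le.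
  by rewrite leeDl// mule_ge0// lee_fin ltW.
by rewrite lteDl// mule_gt0.
Qed.

End Strictness.

(** * Convergence of minima and minimizers *)

(** Monotonicity for a possibly nonmeasurable majorant: the integral is a
    supremum over simple functions below the integrand. *)
Lemma ge0_integral_mono {R : realType} {d : measure_display} {T : measurableType d}
    (mu : {measure set T -> \bar R}) (f g : T -> \bar R) :
  (forall x, (0 <= f x)%E) -> (forall x, (f x <= g x)%E) ->
  (\int[mu]_x f x <= \int[mu]_x g x)%E.
Proof.
move=> f0 fg; have g0 x : (0 <= g x)%E by exact: le_trans (fg x).
rewrite !ge0_integralTE//; apply: le_ereal_sup => _ [h /= hf <-].
by exists h => // x; exact: le_trans (fg x).
Qed.

Theorem theorem3p5 (R : realType) (k : nat) (k_ge1 : (1 <= k)%N)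
  (X : completeNormedModType R)
  (X_reflexive : reflexive_space X) (X_separable : separable X)
  (P : probability (borel X) R)
  (disp : measure_display) (Omega : measurableType disp)
  (Pr : probability Omega R)
  (xi : nat -> {RV Pr >-> borel X})
  (xi_indep : mutually_independent xi)
  (xi_law : forall (i : nat) (A : set (borel X)), measurable A ->
     distribution Pr (xi i) A = P A)
  (d : X -> X -> R) (d_ge0 : forall x y, 0 <= d x y)
  (m M : R -> R)
  (m_ge0 : forall r : R, 0 <= r -> 0 <= m r)
  (M_ge0 : forall r : R, 0 <= r -> 0 <= M r)
  (m_cont : {within `[0, +oo[, continuous m})
  (M_cont : {within `[0, +oo[, continuous M})
  (m_incr : forall r s : R, 0 <= r -> r < s -> m r < m s)
  (M_incr : forall r s : R, 0 <= r -> r < s -> M r < M s)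
  (d_bounds : forall x y : X, m `|x - y| <= d x y /\ d x y <= M `|x - y|)
  (m_infty : m r @[r --> +oo] --> +oo)
  (M0 : M 0 = 0)
  (M_doubling : exists gamma : R, forall x y : X,
     M `|x + y| <= gamma * M `|x| + gamma * M `|y|)
  (M_integrable : (\int[P]_x (M `|(x : X)|)%:E < +oo)%E)
  (d_lsc : forall (x y : X) (xs ys : nat -> X),
     xs n @[n --> \oo] --> x -> weak_cvg ys y ->
     ((d x y)%:E <= limf_einf (fun p : nat * nat => (d (xs p.1) (ys p.2))%:E)
                              (filter_prod \oo \oo))%E /\
     d (xs n) y @[n --> \oo] --> d x y)
  (d_meas : forall y : X, measurable_fun [set: borel X] (fun x : borel X => d x y))
  (P_points : exists mud : 'I_k -> X, injective mud /\
     forall (delta : R) (j : 'I_k), 0 < delta -> (0 < P (ball (mud j) delta))%E) :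
  let f_n (w : Omega) (n : nat) := kmeans_emp d n (fun i => xi i w) in
  let f_infty := kmeans_lim d P in
  (exists v : \bar R, is_min (f_infty : kprod X k -> \bar R) v /\
     {ae Pr, forall w, exists vn : nat -> \bar R,
        (forall n, (1 <= n)%N -> is_min (f_n w n : kprod X k -> \bar R) (vn n)) /\
        vn n @[n --> \oo] --> v}) /\
  {ae Pr, forall w, forall mu : nat -> kprod X k,
     (forall n, (1 <= n)%N -> is_minimizer (f_n w n) (mu n)) ->
     weakly_precompact mu /\
     forall l, weak_limit_point mu l -> is_minimizer f_infty l}.
Proof.
move=> f_n f_infty.
have d_lsc' (x y : X) (xs ys : nat -> X) (xsx : xs n @[n --> \oo] --> x)
  (ysy : weak_cvg ys y) := (d_lsc x y xs ys xsx ysy).1.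
have d_ge_m x y : m `|x - y| <= d x y := (d_bounds x y).1.
have [a a_dense] := separable_dense_seq X_separable.
have minimizer := kmeans_minimizer d d_ge0 d_meas d_lsc' m m_infty d_ge_m
  X_reflexive X_separable.
have [mu0 mu0_min] : exists mu0 : kprod X k, is_minimizer f_infty mu0 := minimizer k P.
pose v := f_infty mu0.
have v_lty : (v < +oo)%E.
  apply: le_lt_trans M_integrable; apply: le_trans (mu0_min 0) _.
  apply: ge0_integral_mono => x; first exact: min_dist_ge0.
  apply: le_trans (min_dist_le d x 0 (Ordinal k_ge1)) _.
  by rewrite ffunE lee_fin -[x in `|x|]subr0; exact: (d_bounds x 0).2.
have v_ge0 : (0 <= v)%E by apply: integral_ge0 => x _; exact: min_dist_ge0.
have v_fin : v \is a fin_num by rewrite ge0_fin_numE.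
have strict (J : {set 'I_k}) l j : j \notin J -> (v < \int[P]_x min_dist_on d J x l)%E.
  move=> jJ; have [p [p_inj p_support]] := P_points.
  have := leey (\int[P]_x min_dist_on d J x l)%E.
  rewrite le_eqVlt => /predU1P[->//|Jfin].
  have [mu] := min_dist_on_improvable d d_ge0 d_meas m M m_ge0 m_incr M_cont M0
    d_bounds P p p_inj p_support J l j jJ Jfin.
  exact: le_lt_trans (mu0_min mu).
have empE w n (mu : kprod X k) : (1 <= n)%N ->
    f_n w n mu = (\int[empirical_measure n (fun i => xi i w : borel X)]_x min_dist d x mu)%E.
  move=> n1; rewrite integral_empirical//; first exact: measurable_min_dist.
  by move=> x; exact: min_dist_ge0.
have emp_minimizer w n : (1 <= n)%N -> exists mu : kprod X k, is_minimizer (f_n w n) mu.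
  move=> n1; have [mu muP] := minimizer k (empirical_measure n (fun i => xi i w : borel X)).
  by exists mu => nu; rewrite !empE.
(* The only two properties of the sample used below; the rest of the argument
   is deterministic. *)
pose good w :=
  (forall s c, (c%:E < \int[P]_x (step_max a s x)%:E)%E -> \forall n \near \oo,
      (c%:E <= \int[empirical_measure n (fun i => xi i w)]_x (step_max a s x)%:E)%E) /\
  (forall c, (v < c%:E)%E -> \forall n \near \oo, (f_n w n mu0 <= c%:E)%E).
have good_ae : {ae Pr, forall w, good w}.
  apply: filterS2 (empirical_steps_ae xi xi_indep xi_law a) _ => [w sw uw|].
    by split; [exact: sw|exact: uw].
  pose phi (x : borel X) : R := fine (min_dist d x mu0).
  have phiE x : (phi x)%:E = min_dist d x mu0.
    rewrite fineK// ge0_fin_numE ?min_dist_ge0//.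
    exact: le_lt_trans (min_dist_le d x mu0 (Ordinal k_ge1)) (ltry _).
  have mphi : measurable_fun setT phi.
    apply/measurable_EFinP; rewrite (_ : _ \o _ = fun x => min_dist d x mu0).
      exact: measurable_min_dist.
    by apply/funext => x; exact: phiE.
  have phi0 x : 0 <= phi x by rewrite fine_ge0// min_dist_ge0.
  have ephi : (\int[P]_x (phi x)%:E = (fine v)%:E)%E.
    by rewrite fineK//; apply: eq_integral => x _; exact: phiE.
  apply: filterS (slln_upper xi xi_indep xi_law phi (fine v) mphi phi0 ephi) => w slln c.
  rewrite -(fineK v_fin) lte_fin => vc.
  have [|N _ NP] := slln (c - fine v); first by rewrite subr_gt0.
  exists N.+1 => // n /= Nn.
  rewrite /f_n /kmeans_emp (eq_bigr (fun i => (phi (xi i w))%:E)); last first.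
    by move=> i _; rewrite phiE.
  have n0 : 0 < n%:R :> R by rewrite ltr0n (leq_trans _ Nn).
  rewrite sumEFin -EFinM lee_fin ler_pdivrMl//.
  by apply: le_trans (NP n (ltnW Nn)) _; rewrite addrC subrK.
(* Lower bound along the subsequence against upper bound at [mu0]. *)
have core w : good w -> forall (h : nat -> nat) (u : nat -> kprod X k) J l,
    increasing_seq h -> partial_weak_cvg J u l ->
    (forall n, (1 <= h n)%N -> is_minimizer (f_n w (h n)) (u n)) ->
    (\int[P]_x min_dist_on d J x l <= v)%E.
  move=> [steps upper] h u J l hi uJ umin; rewrite leNgt; apply/negP.
  move=> /ereal_real_between[c [vc /ereal_real_between[c' [cc' c'J]]]].
  have lower := kmeans_gamma_liminf d d_ge0 d_meas d_lsc' m m_infty d_ge_m a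
    a_dense P _ steps J u l h c' hi uJ c'J.
  have upper_h := increasing_seq_cvg h hi _ (upper c vc).
  have [n [/= [low up] n1]] : exists n,
      ((c'%:E <= \int[empirical_measure (h n) (fun i => xi i w)]_x min_dist d x (u n))%E
      /\ (f_n w (h n) mu0 <= c%:E)%E) /\ (1 <= n)%N.
    have : \forall n \near \oo, (1 <= n)%N by exists 1%N.
    move/(filterI (filterI lower upper_h)) => /filter_ex[n ?]; by exists n.
  have hn1 : (1 <= h n)%N by exact: leq_trans (increasing_seq_ge h n hi).
  move: low; rewrite -empE// => /le_trans/(_ (umin n hn1 mu0))/le_trans/(_ up).
  by rewrite leNgt cc'.
split.
  exists v; split; first by exists mu0.
  apply: filterS good_ae => w gw.
  have [|u uP] := @choice nat (kprod X k) (fun n mu => (1 <= n)%N -> is_minimizer (f_n w n) mu).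
    move=> n; have [->|n1] := posnP n; first by exists 0.
    by have [mu muP] := emp_minimizer w n n1; exists mu.
  exists (fun n => f_n w n (u n)); split=> [n n1|].
    by exists (u n) => //; exact: uP.
  have n_ge1 : \forall n \near \oo, (1 <= n)%N by exists 1%N.
  have above c : (v < c%:E)%E -> \forall n \near \oo, (f_n w n (u n) <= c%:E)%E.
    move=> vc; apply: filterS2 n_ge1 (gw.2 c vc) => n n1; apply: le_trans.
    exact: uP.
  (* Otherwise a subsequence of minimizers stays below [c], and its limit has
     energy less than the minimum [v]. *)
  have below c : (c%:E < v)%E -> \forall n \near \oo, (c%:E <= f_n w n (u n))%E.
    move=> cv; apply: contrapT => nnear.
    have [|h hi hP] := subseq_of_frequently
        (fun _ n => (1 <= n)%N /\ (f_n w n (u n) < c%:E)%E).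
      move=> _ N; apply: contrapT => nfreq; apply: nnear; exists (maxn N 1) => // n.
      rewrite /= geq_max => /andP[Nn n1]; rewrite leNgt; apply/negP => nc.
      by apply: nfreq; exists n.
    have [g [J [l [gi uJ]]]] := partial_weak_cvg_extraction (u \o h) X_reflexive X_separable.
    have cJ : (c%:E < \int[P]_x min_dist_on d J x l)%E.
      apply: lt_le_trans cv _; apply: le_trans (mu0_min l) _.
      apply: ge0_integral_mono => x; first exact: min_dist_ge0.
      exact: min_dist_le_on.
    have [n _ /(_ n (leqnn n)) /=] := kmeans_gamma_liminf d d_ge0 d_meas d_lsc' m
      m_infty d_ge_m a a_dense P _ gw.1 J _ l (h \o g) c
      (increasing_seq_comp h g hi gi) uJ cJ.
    have [n1 nc] := hP (g n).
    by rewrite -empE// leNgt nc.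
  rewrite -(fineK v_fin); apply/fine_cvgP; split.
    have := above (fine v + 1); rewrite -{1}(fineK v_fin) lte_fin => /(_ ltac:(lra)).
    apply: filterS2 n_ge1 => n n1 up.
    rewrite ge0_fin_numE ?(le_lt_trans up) ?ltry// empE//.
    by apply: integral_ge0 => x _; exact: min_dist_ge0.
  apply/(@pseudometric_normed_Zmodule.cvgrPdist_le _ R^o) => eps eps0.
  have up : (v < (fine v + eps)%:E)%E by rewrite -{1}(fineK v_fin) lte_fin; lra.
  have low : ((fine v - eps)%:E < v)%E by rewrite -{2}(fineK v_fin) lte_fin; lra.
  apply: filterS2 (above _ up) (below _ low) => n /=.
  case: (f_n w n (u n)) => [r| |] //; rewrite !lee_fin => h1 h2.
  by rewrite /= ler_distl; lra.
apply: filterS good_ae => w gw mu mumin.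
split=> [h hi|l [h [hi mul]]].
  have [g [J [l [gi uJ]]]] := partial_weak_cvg_extraction (mu \o h) X_reflexive X_separable.
  have hgi := increasing_seq_comp h g hi gi.
  have Jv := core w gw (h \o g) _ J l hgi uJ (fun n => mumin (h (g n))).
  exists l, g; split=> //; apply/weak_cvg_kprodP => j.
  apply: uJ.1; apply: contraT => jJ.
  by move: Jv; rewrite leNgt (strict J l j jJ).
have wl : partial_weak_cvg [set: 'I_k]%SET (mu \o h) l.
  split=> j; last by rewrite inE.
  by move=> _; exact: (weak_cvg_kprodP _ _).1 mul j.
have := core w gw h _ _ l hi wl (fun n => mumin (h n)).
under eq_integral do rewrite min_dist_onT.
by move=> lv nu; apply: le_trans (mu0_min nu).
Qed.
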